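(* There is a universal constant $K>0$ such that the following holds. Let $(X,d)$ be the set of leaves of a finite rooted tree with positive edge lengths, with the weighted shortest-path distance, $n=|X|\ge 2$, and $D$ the combinatorial depth of the tree. Then there is a randomized online algorithm $\boldsymbol\rho$ for MTS on $(X,d)$ such that for every initial state and every cost sequence $\mathbf c$, \[ S_{\boldsymbol\rho}(\mathbf c)\le \mathsf{cost}^*(\mathbf c)\qquad\text{and}\qquad M_{\boldsymbol\rho}(\mathbf c)\le K\,D\log n\,\big(\mathsf{cost}^*(\mathbf c)+\mathrm{diam}(X)\big). \]
   Context: MTS on a finite metric space $(X,d)$: a fixed initial state $\rho_0\in X$; input a finite sequence $\mathbf c=\langle c_1,\dots,c_T\rangle$ of cost functions $c_t:X\to\mathbb R_+$; a randomized online algorithm chooses a random state $\rho_t$ whose law depends only on $c_1,\dots,c_t$. The expected service cost and movement cost are $S_{\boldsymbol\rho}(\mathbf c)=\mathbb E\sum_t c_t(\rho_t)$ and $M_{\boldsymbol\rho}(\mathbf c)=\mathbb E\sum_t d(\rho_{t-1},\rho_t)$. The offline optimum $\mathsf{cost}^*(\mathbf c)$ is the infimum of $\sum_t[c_t(\rho_t)+d(\rho_{t-1},\rho_t)]$ over all deterministic state sequences starting at $\rho_0$. The combinatorial depth of a rooted tree is the maximum number of edges on a root-to-leaf path. *)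

(* Defs.v *)
From Stdlib Require Import Reals List Arith.
Import ListNotations.
Open Scope R_scope.

(* ---------- Weighted rooted trees ----------
   A finite rooted tree with N vertices labelled 0..N-1, root 0, parent
   function [par] with [par v < v] for every non-root vertex (every finite
   rooted tree admits such a labelling), and [wt v > 0] the length of the
   edge between v and [par v]. *)
Record wtree := WTree { tN : nat; tpar : nat -> nat; twt : nat -> R }.

Definition wf_tree (t : wtree) : Prop :=
  (1 <= tN t)%nat /\
  (forall v, (0 < v < tN t)%nat -> (tpar t v < v)%nat) /\
  (forall v, (0 < v < tN t)%nat -> 0 < twt t v).

Definition is_leafb (t : wtree) (v : nat) : bool :=
  Nat.ltb v (tN t) &&
  forallb (fun u => negb (Nat.eqb (tpar t u) v)) (seq 1 (tN t - 1)).

Definition leaves (t : wtree) : list nat := filter (is_leafb t) (seq 0 (tN t)).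

Fixpoint anc_fuel (t : wtree) (k v : nat) : list nat :=
  match k with
  | O => [v]
  | S k' => if Nat.eqb v 0 then [0%nat] else v :: anc_fuel t k' (tpar t v)
  end.
Definition anc (t : wtree) (v : nat) : list nat := anc_fuel t (tN t) v.

Definition rsum (l : list R) : R := fold_right Rplus 0 l.

Definition memb (x : nat) (l : list nat) : bool := existsb (Nat.eqb x) l.

(* weighted shortest-path distance in the tree: total length of the
   edges (x, par x) with x an ancestor of exactly one of u, v *)
Definition tdist (t : wtree) (u v : nat) : R :=
  rsum (map (twt t) (filter (fun x => negb (memb x (anc t v))) (anc t u))) +
  rsum (map (twt t) (filter (fun x => negb (memb x (anc t u))) (anc t v))).

Definition comb_depth (t : wtree) : nat :=
  fold_right Nat.max 0%nat (map (fun v => (length (anc t v) - 1)%nat) (leaves t)).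

Definition diamX (t : wtree) : R :=
  fold_right Rmax 0
    (flat_map (fun u => map (fun v => tdist t u v) (leaves t)) (leaves t)).

Definition costfun := nat -> R.

Definition valid_costs (t : wtree) (cs : list costfun) : Prop :=
  forall c x, In c cs -> In x (leaves t) -> 0 <= c x.

Fixpoint seqs (L : list nat) (T : nat) : list (list nat) :=
  match T with
  | O => [[]]
  | S T' => flat_map (fun x => map (cons x) (seqs L T')) L
  end.

Fixpoint path_cost (t : wtree) (prev : nat) (cs : list costfun) (xs : list nat) : R :=
  match cs, xs with
  | c :: cs', x :: xs' => c x + tdist t prev x + path_cost t x cs' xs'
  | _, _ => 0
  end.

Definition opt_cost (t : wtree) (rho0 : nat) (cs : list costfun) : R :=
  match map (path_cost t rho0 cs) (seqs (leaves t) (length cs)) with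
  | [] => 0
  | a :: l => fold_right Rmin a l
  end.

(* A randomized online algorithm, given as its sequence of conditional laws:
   [alg [c_1;..;c_t] [rho_0;..;rho_{t-1}] x] = probability that rho_t = x
   given the past states, which may depend only on c_1..c_t. *)
Definition online_alg := list costfun -> list nat -> nat -> R.

Definition valid_alg (t : wtree) (alg : online_alg) : Prop :=
  forall cs hist,
    (forall x, In x (leaves t) -> 0 <= alg cs hist x) /\
    rsum (map (alg cs hist) (leaves t)) = 1.

(* Expectation of sum_t f c_t rho_{t-1} rho_t for the random process
   generated by [alg], computed by conditioning on the history. *)
Fixpoint expect (t : wtree) (alg : online_alg) (f : costfun -> nat -> nat -> R)
  (cdone : list costfun) (hist : list nat) (cs : list costfun) : R :=
  match cs with
  | [] => 0
  | c :: cs' =>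
      let cd := cdone ++ [c] in
      rsum (map (fun x => alg cd hist x *
                   (f c (last hist 0%nat) x + expect t alg f cd (hist ++ [x]) cs'))
                (leaves t))
  end.

Definition service_cost (t : wtree) (alg : online_alg) (rho0 : nat) (cs : list costfun) : R :=
  expect t alg (fun c _ x => c x) [] [rho0] cs.
Definition movement_cost (t : wtree) (alg : online_alg) (rho0 : nat) (cs : list costfun) : R :=
  expect t alg (fun _ p x => tdist t p x) [] [rho0] cs.

(* Main.v *)
(* Online mirror descent on the subtree masses.  Write m_v for the probability of the
   leaves below v, d_v for the fraction of leaves below v, w_v for the length of the
   edge above v, eta = 2 ln n.  The regularizer is
   (1/eta) sum_v w_v (m_v + d_v) ln (m_v + d_v), and a cost c moves a = m + d to the
   proximal point b, which is characterized by multipliers lam >= 0 with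
   w_v ln (b_v / a_v) = eta (lam_(parent v) - lam_v),  lam_l <= c_l at the leaves, and
   equality there wherever the new mass is nonzero.

   Service: for every leaf r, the Bregman divergence from the point mass at r drops by
   at least <c, new> - c_r, and it is 1-Lipschitz in r; it vanishes at the start.

   Movement: summation by parts along root-leaf paths turns sum_v a_v lam_v into
   sum_l depth_l a_l lam_l plus the increment of a potential; the part of that sum due
   to d_l is paid by a second, logarithmic potential.  All these potentials vary by
   O(depth * diameter) over the whole run.

   The laws are turned into a process by an optimal coupling of consecutive laws,
   whose cost on a tree is sum_v w_v |m_v - m'_v|. *)

Require Import Defs.
From Stdlib Require Import Reals List Arith Bool Lra Lia.
From Stdlib Require Import Classical ClassicalEpsilon.
Import ListNotations.
Open Scope R_scope.

(** * Finite sums *)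

Definition sumf (l : list nat) (f : nat -> R) : R := rsum (map f l).

Lemma sumf_nil f : sumf [] f = 0.
Proof. reflexivity. Qed.

Lemma sumf_cons x l f : sumf (x :: l) f = f x + sumf l f.
Proof. reflexivity. Qed.

Lemma sumf_app l1 l2 f : sumf (l1 ++ l2) f = sumf l1 f + sumf l2 f.
Proof.
  induction l1 as [|x l1 IH]; simpl app; rewrite ?sumf_nil, ?sumf_cons, ?IH; lra.
Qed.

Lemma sumf_ext l f g : (forall x, In x l -> f x = g x) -> sumf l f = sumf l g.
Proof.
  intros H; unfold sumf; f_equal; apply map_ext_in; exact H.
Qed.

Lemma sumf_le l f g : (forall x, In x l -> f x <= g x) -> sumf l f <= sumf l g.
Proof.
  induction l as [|x l IH]; intros H; [rewrite !sumf_nil; lra|].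
  rewrite !sumf_cons; apply Rplus_le_compat; [apply H; now left|].
  apply IH; intros; apply H; now right.
Qed.

Lemma sumf_plus l f g : sumf l (fun x => f x + g x) = sumf l f + sumf l g.
Proof.
  induction l as [|x l IH]; rewrite ?sumf_nil, ?sumf_cons, ?IH; lra.
Qed.

Lemma sumf_scal l a f : sumf l (fun x => a * f x) = a * sumf l f.
Proof.
  induction l as [|x l IH]; rewrite ?sumf_nil, ?sumf_cons, ?IH; lra.
Qed.

Lemma sumf_scal_r l a f : sumf l (fun x => f x * a) = sumf l f * a.
Proof.
  induction l as [|x l IH]; rewrite ?sumf_nil, ?sumf_cons, ?IH; lra.
Qed.

Lemma sumf_minus l f g : sumf l (fun x => f x - g x) = sumf l f - sumf l g.
Proof.
  induction l as [|x l IH]; rewrite ?sumf_nil, ?sumf_cons, ?IH; lra.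
Qed.

Lemma sumf_const l a : sumf l (fun _ => a) = INR (length l) * a.
Proof.
  induction l as [|x l IH]; [rewrite sumf_nil; simpl; lra|].
  rewrite sumf_cons, IH; change (length (x :: l)) with (S (length l)).
  rewrite S_INR; lra.
Qed.

Lemma sumf_0 l f : (forall x, In x l -> f x = 0) -> sumf l f = 0.
Proof.
  intros H; rewrite (sumf_ext l f (fun _ => 0) H), sumf_const; lra.
Qed.

Lemma sumf_nonneg l f : (forall x, In x l -> 0 <= f x) -> 0 <= sumf l f.
Proof.
  intros H; rewrite <- (sumf_0 l (fun _ => 0)) by reflexivity; now apply sumf_le.
Qed.

Lemma sumf_swap l1 l2 f :
  sumf l1 (fun x => sumf l2 (f x)) = sumf l2 (fun y => sumf l1 (fun x => f x y)).
Proof.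
  induction l1 as [|x l IH].
  - rewrite sumf_nil, sumf_0; auto.
  - rewrite sumf_cons, IH, <- sumf_plus; reflexivity.
Qed.

Lemma sumf_ge_term l f k :
  (forall x, In x l -> 0 <= f x) -> In k l -> f k <= sumf l f.
Proof.
  induction l as [|x l IH]; intros H Hk; [destruct Hk|].
  rewrite sumf_cons.
  assert (0 <= sumf l f) by (apply sumf_nonneg; intros; apply H; now right).
  assert (0 <= f x) by (apply H; now left).
  destruct Hk as [->|Hk]; [lra|].
  assert (f k <= sumf l f) by (apply IH; [intros; apply H; now right|exact Hk]).
  lra.
Qed.

Lemma sumf_eq0 l f :
  (forall x, In x l -> 0 <= f x) -> sumf l f = 0 -> forall x, In x l -> f x = 0.
Proof.
  intros H H0 x Hx; pose proof (sumf_ge_term l f x H Hx); specialize (H x Hx); lra.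
Qed.

Lemma sumf_abs l f : Rabs (sumf l f) <= sumf l (fun x => Rabs (f x)).
Proof.
  induction l as [|x l IH]; [rewrite !sumf_nil, Rabs_R0; lra|].
  rewrite !sumf_cons; pose proof (Rabs_triang (f x) (sumf l f)); lra.
Qed.

Lemma sumf_single l k g :
  NoDup l -> In k l -> sumf l (fun x => if Nat.eqb x k then g x else 0) = g k.
Proof.
  induction l as [|x l IH]; intros Hd Hk; [destruct Hk|].
  inversion_clear Hd as [|? ? Hx Hl]; rewrite sumf_cons.
  destruct (Nat.eqb_spec x k) as [->|Hne].
  - rewrite sumf_0; [lra|]; intros y Hy.
    destruct (Nat.eqb_spec y k) as [->|]; [contradiction|reflexivity].
  - destruct Hk as [->|Hk]; [congruence|]; rewrite IH by assumption; lra.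
Qed.

Lemma sumf_filter l P f :
  sumf (filter P l) f = sumf l (fun x => if P x then f x else 0).
Proof.
  induction l as [|x l IH]; [reflexivity|]; simpl filter.
  destruct (P x) eqn:E; rewrite !sumf_cons, ?IH, ?E; lra.
Qed.

Lemma sumf_seq_S n f : sumf (seq 0 (S n)) f = sumf (seq 0 n) f + f n.
Proof.
  rewrite seq_S, sumf_app, sumf_cons, sumf_nil; simpl; lra.
Qed.

(** * Trees *)

(** Real-valued, and 1 also for [v = u], so that subtree masses are linear in it and path lengths
    are sums over edges. *)
Definition ancI (t : wtree) (v u : nat) : R := if memb v (anc t u) then 1 else 0.

(** An edge is named by its lower endpoint, hence by a vertex other than the root 0. *)
Definition edges (t : wtree) : list nat := seq 1 (tN t - 1).

Definition depth (t : wtree) (v : nat) : R := INR (length (anc t v) - 1).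

Definition children (t : wtree) (u : nat) : list nat :=
  filter (fun v => Nat.eqb (tpar t v) u) (edges t).

Lemma memb_In x l : memb x l = true <-> In x l.
Proof.
  unfold memb; rewrite existsb_exists; split.
  - intros (y & Hy & E); apply Nat.eqb_eq in E; now subst.
  - intros H; exists x; split; [exact H|apply Nat.eqb_refl].
Qed.

Section Tree.

Variable t : wtree.
Hypothesis Hwf : wf_tree t.

Lemma in_edges v : In v (edges t) <-> (0 < v < tN t)%nat.
Proof. unfold edges; rewrite in_seq; lia. Qed.

Lemma edge_lt v : In v (edges t) -> (v < tN t)%nat.
Proof. intros H; apply in_edges in H; lia. Qed.

Lemma par_lt v : (0 < v < tN t)%nat -> (tpar t v < v)%nat.
Proof. apply Hwf. Qed.

(** Labels strictly decrease towards the root, so any fuel of at least [v] reaches it. *)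
Lemma anc_fuel_stable k1 k2 v :
  (v < tN t)%nat -> (v <= k1)%nat -> (v <= k2)%nat -> anc_fuel t k1 v = anc_fuel t k2 v.
Proof.
  revert k2 v; induction k1 as [|k1 IH]; intros [|k2] v Hv H1 H2; simpl.
  - reflexivity.
  - replace v with 0%nat by lia; reflexivity.
  - replace v with 0%nat by lia; reflexivity.
  - destruct (Nat.eqb_spec v 0); [reflexivity|].
    assert (tpar t v < v)%nat by (apply par_lt; lia).
    f_equal; apply IH; lia.
Qed.

Lemma anc_0 : anc t 0 = [0%nat].
Proof. unfold anc; destruct (tN t); reflexivity. Qed.

Lemma anc_S v : (0 < v < tN t)%nat -> anc t v = v :: anc t (tpar t v).
Proof.
  intros Hv; pose proof (par_lt v Hv) as Hp; unfold anc.
  destruct (tN t) as [|N] eqn:E; [lia|]; simpl.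
  destruct (Nat.eqb_spec v 0); [lia|]; f_equal.
  change (anc_fuel t N (tpar t v) = anc_fuel t (S N) (tpar t v)).
  apply anc_fuel_stable; lia.
Qed.

Lemma tree_ind (P : nat -> Prop) :
  P 0%nat ->
  (forall v, (0 < v < tN t)%nat -> (forall u, (u < v)%nat -> P u) -> P (tpar t v) -> P v) ->
  forall v, (v < tN t)%nat -> P v.
Proof.
  intros H0 HS v; induction v as [v IH] using lt_wf_ind; intros Hv.
  destruct (Nat.eq_dec v 0) as [->|Hne]; [exact H0|].
  pose proof (par_lt v ltac:(lia)).
  apply HS; [lia| |]; intros; apply IH; lia.
Qed.

Lemma anc_le v u : (u < tN t)%nat -> In v (anc t u) -> (v <= u)%nat.
Proof.
  revert u; apply (tree_ind (fun u => In v (anc t u) -> (v <= u)%nat)).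
  - rewrite anc_0; intros [<-|[]]; lia.
  - intros u Hu _ IH; rewrite anc_S by exact Hu.
    pose proof (par_lt u Hu); intros [<-|H1]; [lia|]; specialize (IH H1); lia.
Qed.

Lemma ancI_0 v : ancI t v 0 = if Nat.eqb v 0 then 1 else 0.
Proof. unfold ancI; rewrite anc_0; simpl; rewrite orb_false_r; reflexivity. Qed.

Lemma ancI_gt v u : (u < tN t)%nat -> (u < v)%nat -> ancI t v u = 0.
Proof.
  intros Hu Hv; unfold ancI; destruct (memb v (anc t u)) eqn:E; [|reflexivity].
  apply memb_In, anc_le in E; [lia|exact Hu].
Qed.

Lemma ancI_S v u :
  (0 < u < tN t)%nat ->
  ancI t v u = (if Nat.eqb u v then 1 else 0) + ancI t v (tpar t u).
Proof.
  intros Hu; pose proof (par_lt u Hu).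
  destruct (Nat.eqb_spec u v) as [<-|Hne].
  - rewrite (ancI_gt u (tpar t u)) by lia.
    unfold ancI; rewrite anc_S by exact Hu; simpl; rewrite Nat.eqb_refl; simpl; lra.
  - unfold ancI; rewrite anc_S by exact Hu; simpl.
    destruct (Nat.eqb_spec v u); [congruence|]; simpl; lra.
Qed.

Lemma ancI_refl v : (v < tN t)%nat -> ancI t v v = 1.
Proof.
  intros Hv; destruct (Nat.eq_dec v 0) as [->|Hne]; [rewrite ancI_0; reflexivity|].
  pose proof (par_lt v ltac:(lia)).
  rewrite ancI_S, Nat.eqb_refl, (ancI_gt v (tpar t v)) by lia; lra.
Qed.

Lemma ancI_root u : (u < tN t)%nat -> ancI t 0 u = 1.
Proof.
  revert u; apply tree_ind; [rewrite ancI_0; reflexivity|].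
  intros u Hu _ IH; rewrite ancI_S, IH by exact Hu.
  destruct (Nat.eqb_spec u 0); [lia|lra].
Qed.

Lemma ancI_01 v u : ancI t v u = 0 \/ ancI t v u = 1.
Proof. unfold ancI; destruct (memb v (anc t u)); auto. Qed.

Lemma NoDup_edges : NoDup (edges t).
Proof. apply seq_NoDup. Qed.

Lemma sumf_ancI_S u g :
  (0 < u < tN t)%nat ->
  sumf (edges t) (fun v => ancI t v u * g v) =
  g u + sumf (edges t) (fun v => ancI t v (tpar t u) * g v).
Proof.
  intros Hu.
  rewrite <- (sumf_single (edges t) u g NoDup_edges) by (now apply in_edges).
  rewrite <- sumf_plus; apply sumf_ext; intros v _.
  rewrite (ancI_S v u Hu), (Nat.eqb_sym u v); destruct (Nat.eqb v u); lra.
Qed.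

Lemma sumf_ancI_root g : sumf (edges t) (fun v => ancI t v 0 * g v) = 0.
Proof.
  apply sumf_0; intros v Hv; apply in_edges in Hv.
  rewrite ancI_0; destruct (Nat.eqb_spec v 0); [lia|lra].
Qed.

Lemma path_telescope phi w :
  (w < tN t)%nat ->
  sumf (edges t) (fun v => ancI t v w * (phi (tpar t v) - phi v)) = phi 0%nat - phi w.
Proof.
  revert w; apply tree_ind; [rewrite sumf_ancI_root; lra|].
  intros w Hw _ IH; rewrite sumf_ancI_S by exact Hw; rewrite IH; lra.
Qed.

(** Passes from ancestor lists to edge sums. The lists contain the root, which names no edge; hence
    [P 0%nat = false]. *)
Lemma sumf_anc (P : nat -> bool) g u :
  P 0%nat = false -> (u < tN t)%nat ->
  sumf (filter P (anc t u)) g =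
  sumf (edges t) (fun v => ancI t v u * (if P v then g v else 0)).
Proof.
  intros HP; revert u; apply tree_ind.
  - rewrite anc_0, sumf_ancI_root; simpl; rewrite HP; reflexivity.
  - intros u Hu _ IH; rewrite anc_S, sumf_ancI_S by exact Hu; rewrite <- IH; simpl.
    destruct (P u); [rewrite sumf_cons|]; lra.
Qed.

(** * Distances as sums over edges *)

Lemma tdist_sum u w :
  (u < tN t)%nat -> (w < tN t)%nat ->
  tdist t u w = sumf (edges t) (fun v => twt t v * Rabs (ancI t v u - ancI t v w)).
Proof.
  intros Hu Hw; unfold tdist; fold (sumf (filter (fun x => negb (memb x (anc t w))) (anc t u)) (twt t)).
  fold (sumf (filter (fun x => negb (memb x (anc t u))) (anc t w)) (twt t)).
  (* The root is a common ancestor, so neither filter keeps it, as [sumf_anc] requires. *)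
  assert (Hr : forall x, (x < tN t)%nat -> negb (memb 0 (anc t x)) = false).
  { intros x Hx; pose proof (ancI_root x Hx) as E; unfold ancI in E.
    destruct (memb 0 (anc t x)); [reflexivity|lra]. }
  rewrite !sumf_anc by auto; rewrite <- sumf_plus; apply sumf_ext; intros v _.
  unfold ancI; destruct (memb v (anc t u)), (memb v (anc t w)); simpl.
  - replace (1 - 1) with 0 by lra; rewrite Rabs_R0; lra.
  - rewrite Rabs_pos_eq; lra.
  - rewrite Rabs_left; lra.
  - replace (0 - 0) with 0 by lra; rewrite Rabs_R0; lra.
Qed.

Lemma wt_pos v : In v (edges t) -> 0 < twt t v.
Proof. intros H; apply Hwf; now apply in_edges. Qed.

Lemma tdist_sym u w : tdist t u w = tdist t w u.
Proof. unfold tdist; lra. Qed.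

Lemma tdist_nonneg u w : (u < tN t)%nat -> (w < tN t)%nat -> 0 <= tdist t u w.
Proof.
  intros Hu Hw; rewrite tdist_sum by assumption; apply sumf_nonneg; intros v Hv.
  apply Rmult_le_pos; [left; now apply wt_pos|apply Rabs_pos].
Qed.

Lemma tdist_refl u : (u < tN t)%nat -> tdist t u u = 0.
Proof.
  intros Hu; rewrite tdist_sum by assumption; apply sumf_0; intros v _.
  rewrite Rminus_diag, Rabs_R0; lra.
Qed.

Lemma tdist_par u w :
  (0 < u < tN t)%nat -> (w < tN t)%nat ->
  tdist t u w <= twt t u + tdist t (tpar t u) w.
Proof.
  intros Hu Hw; pose proof (par_lt u Hu).
  rewrite !tdist_sum by lia.
  rewrite <- (sumf_single (edges t) u (twt t) NoDup_edges) by (now apply in_edges).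
  rewrite <- sumf_plus; apply sumf_le; intros v Hv; pose proof (wt_pos v Hv).
  rewrite (ancI_S v u Hu), (Nat.eqb_sym u v); destruct (Nat.eqb_spec v u).
  - pose proof (Rabs_triang 1 (ancI t v (tpar t u) - ancI t v w)) as T.
    rewrite Rabs_R1 in T.
    replace (1 + ancI t v (tpar t u) - ancI t v w)
      with (1 + (ancI t v (tpar t u) - ancI t v w)) by lra.
    nra.
  - rewrite Rplus_0_l; lra.
Qed.

(** Climbing from [w], one can enter [u] only through a single child of [u]; induction along the
    climb locates it. *)
Lemma ancI_children u w :
  (u < tN t)%nat -> (w < tN t)%nat -> w <> u ->
  ancI t u w = sumf (children t u) (fun v => ancI t v w).
Proof.
  intros Hu Hw; revert w Hw.
  apply (tree_ind (fun w => w <> u -> ancI t u w = sumf (children t u) (fun v => ancI t v w))).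
  - intros Hne; rewrite ancI_0; destruct (Nat.eqb_spec u 0); [congruence|].
    symmetry; apply sumf_0; intros v Hv; apply filter_In in Hv as [Hv _].
    apply in_edges in Hv; apply ancI_gt; lia.
  - intros w Hw _ IH Hne; pose proof (par_lt w Hw) as Hp.
    rewrite ancI_S by exact Hw; destruct (Nat.eqb_spec w u); [congruence|].
    rewrite (sumf_ext _ _ (fun v => (if Nat.eqb v w then 1 else 0) + ancI t v (tpar t w)))
      by (intros v _; rewrite (ancI_S v w Hw), Nat.eqb_sym; reflexivity).
    rewrite sumf_plus; unfold children at 1; rewrite sumf_filter.
    rewrite (sumf_ext (edges t) _
      (fun v => if Nat.eqb v w then (if Nat.eqb (tpar t v) u then 1 else 0) else 0))
      by (intros v _; destruct (Nat.eqb v w), (Nat.eqb (tpar t v) u); reflexivity).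
    rewrite sumf_single by (apply NoDup_edges || now apply in_edges).
    destruct (Nat.eqb_spec (tpar t w) u) as [E|E].
    (* Here [w] itself is that child; no child of [u] is an ancestor of [u], having a larger
       label. *)
    + rewrite E, ancI_refl by exact Hu.
      rewrite (sumf_0 (children t u) (fun v => ancI t v u)); [lra|].
      intros v Hv; apply filter_In in Hv as [Hv Hv'].
      apply in_edges in Hv; apply Nat.eqb_eq in Hv'; pose proof (par_lt v Hv).
      apply ancI_gt; lia.
    + rewrite IH by exact E; lra.
Qed.

(** * Depth, leaves and diameter *)

Lemma depth_0 : depth t 0 = 0.
Proof. unfold depth; rewrite anc_0; reflexivity. Qed.

Lemma depth_S v : (0 < v < tN t)%nat -> depth t v = depth t (tpar t v) + 1.
Proof.
  intros Hv; unfold depth; rewrite anc_S by exact Hv.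
  assert (0 < length (anc t (tpar t v)))%nat.
  { destruct (Nat.eq_dec (tpar t v) 0) as [->|]; [rewrite anc_0; simpl; lia|].
    pose proof (par_lt v Hv); rewrite anc_S by lia; simpl; lia. }
  simpl length; rewrite <- S_INR; f_equal; lia.
Qed.

Lemma depth_ge1 v : (0 < v < tN t)%nat -> 1 <= depth t v.
Proof.
  intros Hv; rewrite depth_S by exact Hv; unfold depth.
  pose proof (pos_INR (length (anc t (tpar t v)) - 1)); lra.
Qed.

Lemma in_leaves v :
  In v (leaves t) <-> (v < tN t)%nat /\ children t v = [].
Proof.
  unfold leaves; rewrite filter_In, in_seq; unfold is_leafb.
  rewrite andb_true_iff, Nat.ltb_lt, forallb_forall; unfold children, edges.
  split.
  - intros (_ & H1 & H2); split; [exact H1|].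
    destruct (filter _ _) as [|x l] eqn:E; [reflexivity|].
    assert (Hx : In x (x :: l)) by now left.
    rewrite <- E in Hx; apply filter_In in Hx as [Hx Hx'].
    specialize (H2 x Hx); rewrite Hx' in H2; discriminate.
  - intros (H1 & H2); repeat split; try lia; intros x Hx.
    destruct (Nat.eqb (tpar t x) v) eqn:E; [|reflexivity].
    assert (Hc : In x []) by (rewrite <- H2; apply filter_In; auto).
    destruct Hc.
Qed.

Lemma leaves_lt v : In v (leaves t) -> (v < tN t)%nat.
Proof. intros H; now apply in_leaves in H. Qed.

Lemma NoDup_leaves : NoDup (leaves t).
Proof. apply NoDup_filter, seq_NoDup. Qed.

Lemma in_children v u : In v (children t u) <-> (0 < v < tN t)%nat /\ tpar t v = u.
Proof. unfold children; rewrite filter_In, in_edges, Nat.eqb_eq; reflexivity. Qed.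

Lemma depth_le_comb_depth l : In l (leaves t) -> depth t l <= INR (comb_depth t).
Proof.
  intros Hl; unfold depth, comb_depth; apply le_INR.
  revert Hl; generalize (leaves t) as L; induction L as [|x L IH]; intros Hl; [destruct Hl|].
  simpl map; simpl fold_right; destruct Hl as [->|Hl]; [lia|]; specialize (IH Hl); lia.
Qed.

Lemma tdist_le_diam u v : In u (leaves t) -> In v (leaves t) -> tdist t u v <= diamX t.
Proof.
  intros Hu Hv; unfold diamX.
  assert (H : In (tdist t u v)
    (flat_map (fun u => map (fun v => tdist t u v) (leaves t)) (leaves t))).
  { apply in_flat_map; exists u; split; [exact Hu|]; now apply in_map. }
  revert H; generalize (flat_map (fun u => map (fun v => tdist t u v) (leaves t)) (leaves t)) as L.
  induction L as [|x L IH]; intros H; [destruct H|]; simpl.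
  destruct H as [->|H]; [apply Rmax_l|].
  eapply Rle_trans; [apply IH, H|apply Rmax_r].
Qed.

(** Vertex 1, if present, can only have parent 0, so a childless root is the whole tree. *)
Lemma root_not_leaf : (2 <= length (leaves t))%nat -> ~ In 0%nat (leaves t).
Proof.
  intros Hn H; apply in_leaves in H as [H H'].
  assert (HN : tN t = 1%nat).
  { destruct (Nat.eq_dec (tN t) 1) as [|Hne]; [assumption|].
    assert (Hc : In 1%nat (children t 0)).
    { apply in_children; split; [lia|]; pose proof (par_lt 1 ltac:(lia)); lia. }
    rewrite H' in Hc; destruct Hc. }
  assert (length (leaves t) <= length (seq 0 (tN t)))%nat by apply filter_length_le.
  rewrite length_seq in *; lia.
Qed.

End Tree.

(** * Transport on the tree *)

Definition mass (t : wtree) (p : nat -> R) (v : nat) : R :=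
  sumf (leaves t) (fun l => p l * ancI t v l).

(** Earth mover distance on a tree: under any coupling, the edge above [v] must carry at least the
    difference of the masses below it. *)
Definition emd (t : wtree) (p q : nat -> R) : R :=
  sumf (edges t) (fun v => twt t v * Rabs (mass t p v - mass t q v)).

Definition distr (t : wtree) (p : nat -> R) : Prop :=
  (forall l, In l (leaves t) -> 0 <= p l) /\ sumf (leaves t) p = 1.

Definition is_coupling (l : list nat) (p q : nat -> R) (g : nat -> nat -> R) : Prop :=
  (forall x y, In x l -> In y l -> 0 <= g x y) /\
  (forall x, In x l -> sumf l (g x) = p x) /\
  (forall y, In y l -> sumf l (fun x => g x y) = q y).

Definition coupling_cost (t : wtree) (l : list nat) (g : nat -> nat -> R) : R :=
  sumf l (fun x => sumf l (fun y => g x y * tdist t x y)).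

Section Transport.

Variable t : wtree.
Hypothesis Hwf : wf_tree t.

(** The vertices with label less than [M] span a subtree containing the root, because parents have
    smaller labels. Allowing mass on inner vertices makes induction on [M] possible. *)
Definition transportable (M : nat) (p q : nat -> R) : Prop :=
  exists g, is_coupling (seq 0 M) p q g /\
    coupling_cost t (seq 0 M) g <=
    sumf (seq 1 (M - 1))
      (fun v => twt t v * Rabs (sumf (seq 0 M) (fun u => (p u - q u) * ancI t v u))).

Lemma transportable_sym M p q : transportable M p q -> transportable M q p.
Proof.
  intros (g & (H1 & H2 & H3) & H4); exists (fun x y => g y x); split.
  - split; [|split]; auto.
  - unfold coupling_cost in *; rewrite sumf_swap.
    rewrite (sumf_ext (seq 0 M) _ (fun x => sumf (seq 0 M) (fun y => g x y * tdist t x y)))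
      by (intros x _; apply sumf_ext; intros y _; rewrite (tdist_sym t y x); reflexivity).
    eapply Rle_trans; [exact H4|]; apply Req_le, sumf_ext; intros v _.
    f_equal; rewrite <- Rabs_Ropp; f_equal.
    replace (- sumf (seq 0 M) (fun u => (p u - q u) * ancI t v u))
      with ((-1) * sumf (seq 0 M) (fun u => (p u - q u) * ancI t v u)) by lra.
    rewrite <- sumf_scal; apply sumf_ext; intros; lra.
Qed.

Lemma sumf_seq_single M k g :
  (k < M)%nat -> sumf (seq 0 M) (fun x => if Nat.eqb x k then g x else 0) = g k.
Proof. intros H; apply sumf_single; [apply seq_NoDup|apply in_seq; lia]. Qed.

(* The surplus [p M - q M] of the highest vertex travels to its parent, and from
   there follows the coupling of the remaining vertices. *)
Lemma transportable_push M p q :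
  (1 <= M < tN t)%nat ->
  (forall x, (x <= M)%nat -> 0 <= p x) -> (forall x, (x <= M)%nat -> 0 <= q x) ->
  q M <= p M ->
  transportable M (fun x => p x + (if Nat.eqb x (tpar t M) then p M - q M else 0)) q ->
  transportable (S M) p q.
Proof.
  intros HM Hp Hq Hpq (g & (G1 & G2 & G3) & G4).
  pose proof (par_lt t Hwf M ltac:(lia)) as Hpar.
  set (r := tpar t M) in *; set (s := p M - q M) in *.
  (* [a] is the share of the merged mass [p r + s] at the parent that came from [M]; if that mass is
     zero, so is [s], and [a = 0] works. *)
  assert (Hs : exists a, 0 <= a <= 1 /\ s = a * (p r + s)).
  { pose proof (Hp r ltac:(lia)); destruct (Req_dec (p r + s) 0) as [E|E].
    - exists 0; split; [lra|]; unfold s in *; nra.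
    - exists (s / (p r + s)); unfold s in *; split; [|field; exact E].
      assert (0 < p r + (p M - q M)) by lra.
      split; [apply Rle_mult_inv_pos; lra|].
      apply Rmult_le_reg_r with (p r + (p M - q M)); [lra|].
      unfold Rdiv; rewrite Rmult_assoc, Rinv_l by lra; lra. }
  destruct Hs as (a & Ha & Hsa).
  assert (Hlt : forall x, In x (seq 0 M) <-> (x < M)%nat) by (intros; rewrite in_seq; lia).
  assert (Hgr : sumf (seq 0 M) (g r) = p r + s).
  { rewrite G2 by (apply Hlt; lia); rewrite Nat.eqb_refl; reflexivity. }
  (* [M] keeps [q M] for itself and takes the share [a] of the row of [r]; [r] keeps the rest of its
     row, and nothing else ends at [M]. *)
  set (h := fun x y => if Nat.eqb x M then (if Nat.eqb y M then q M else a * g r y)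
                       else if Nat.eqb y M then 0
                       else if Nat.eqb x r then (1 - a) * g r y else g x y).
  assert (hMM : h M M = q M) by (unfold h; rewrite Nat.eqb_refl; reflexivity).
  assert (hM : forall y, (y < M)%nat -> h M y = a * g r y).
  { intros y Hy; unfold h; rewrite Nat.eqb_refl; destruct (Nat.eqb_spec y M); [lia|reflexivity]. }
  assert (hxM : forall x, (x < M)%nat -> h x M = 0).
  { intros x Hx; unfold h; rewrite Nat.eqb_refl; destruct (Nat.eqb_spec x M); [lia|reflexivity]. }
  assert (hr : forall y, (y < M)%nat -> h r y = (1 - a) * g r y).
  { intros y Hy; unfold h; rewrite Nat.eqb_refl.
    destruct (Nat.eqb_spec r M); [lia|]; destruct (Nat.eqb_spec y M); [lia|reflexivity]. }
  assert (hx : forall x y, (x < M)%nat -> (y < M)%nat ->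
    h x y = g x y - (if Nat.eqb x r then a * g x y else 0)).
  { intros x y Hx Hy; unfold h; destruct (Nat.eqb_spec x M); [lia|].
    destruct (Nat.eqb_spec y M); [lia|]; destruct (Nat.eqb_spec x r) as [->|]; lra. }
  exists h; split; [split; [|split]|].
  - intros x y Hx Hy; apply in_seq in Hx, Hy.
    assert (forall y, (y < M)%nat -> 0 <= g r y) by (intros; apply G1; apply Hlt; lia).
    unfold h; destruct (Nat.eqb_spec x M), (Nat.eqb_spec y M); try lra.
    + apply Hq; lia.
    + apply Rmult_le_pos; [lra|]; auto with zarith.
    + destruct (Nat.eqb_spec x r); [apply Rmult_le_pos; [lra|]; apply H; lia|].
      apply G1; apply Hlt; lia.
  - intros x Hx; apply in_seq in Hx; rewrite sumf_seq_S.
    destruct (Nat.eq_dec x M) as [->|Hne].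
    + rewrite hMM, (sumf_ext _ _ (fun y => a * g r y)) by (intros; apply hM; now apply Hlt).
      rewrite sumf_scal, Hgr, <- Hsa; unfold s; lra.
    + rewrite hxM by lia; destruct (Nat.eq_dec x r) as [->|Hnr].
      * rewrite (sumf_ext _ _ (fun y => (1 - a) * g r y)) by (intros; apply hr; now apply Hlt).
        rewrite sumf_scal, Hgr; lra.
      * rewrite (sumf_ext _ _ (g x)), G2.
        -- destruct (Nat.eqb_spec x r); [congruence|lra].
        -- apply Hlt; lia.
        -- intros y Hy; apply Hlt in Hy; rewrite hx by lia.
           destruct (Nat.eqb_spec x r); [congruence|lra].
  - intros y Hy; apply in_seq in Hy; rewrite sumf_seq_S.
    destruct (Nat.eq_dec y M) as [->|Hne].
    + rewrite hMM, sumf_0; [lra|]; intros x Hx; apply hxM; now apply Hlt.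
    + rewrite hM by lia.
      rewrite (sumf_ext _ _ (fun x => g x y - (if Nat.eqb x r then a * g x y else 0)))
        by (intros x Hx; apply hx; [now apply Hlt|lia]).
      rewrite sumf_minus, (sumf_seq_single M r (fun x => a * g x y)), G3 by (lia || apply Hlt; lia).
      lra.
  - replace (S M - 1)%nat with (S (M - 1)) by lia; rewrite (seq_S (M - 1) 1), sumf_app, sumf_cons, sumf_nil.
    replace (1 + (M - 1))%nat with M by lia.
    (* Among these vertices only [M] lies below the edge above [M], so this edge carries exactly
       [s]. *)
    assert (EM : sumf (seq 0 (S M)) (fun u => (p u - q u) * ancI t M u) = s).
    { rewrite sumf_seq_S, ancI_refl by (assumption || lia).
      rewrite sumf_0; [unfold s; lra|]; intros x Hx; apply Hlt in Hx.
      rewrite ancI_gt by (assumption || lia); lra. }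
    rewrite EM, (Rabs_pos_eq s) by (unfold s; lra).
    (* Any other edge lies above [M] exactly when it lies above [r], so relocating the surplus
       leaves its flow unchanged. *)
    assert (Ev : sumf (seq 1 (M - 1))
        (fun v => twt t v * Rabs (sumf (seq 0 (S M)) (fun u => (p u - q u) * ancI t v u))) =
      sumf (seq 1 (M - 1)) (fun v => twt t v * Rabs (sumf (seq 0 M)
        (fun u => (p u + (if Nat.eqb u r then s else 0) - q u) * ancI t v u)))).
    { apply sumf_ext; intros v Hv; apply in_seq in Hv; do 2 f_equal.
      rewrite sumf_seq_S, (ancI_S t Hwf v M) by lia.
      destruct (Nat.eqb_spec M v); [lia|].
      rewrite (sumf_ext _ (fun u => (p u + (if Nat.eqb u r then s else 0) - q u) * ancI t v u)
        (fun u => (p u - q u) * ancI t v u + (if Nat.eqb u r then s * ancI t v u else 0)))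
        by (intros u _; destruct (Nat.eqb u r); lra).
      rewrite sumf_plus, (sumf_seq_single M r (fun u => s * ancI t v u)) by lia.
      fold r; fold s; lra. }
    rewrite Ev; clear Ev.
    assert (Hc : coupling_cost t (seq 0 (S M)) h <= coupling_cost t (seq 0 M) g + twt t M * s).
    { unfold coupling_cost; rewrite sumf_seq_S.
      rewrite sumf_seq_S, hMM, tdist_refl by (assumption || lia).
      rewrite (sumf_ext (seq 0 M) (fun y => h M y * tdist t M y)
        (fun y => a * (g r y * tdist t M y)))
        by (intros y Hy; rewrite hM by (now apply Hlt); lra).
      rewrite (sumf_ext (seq 0 M) (fun x => sumf (seq 0 (S M)) (fun y => h x y * tdist t x y))
        (fun x => sumf (seq 0 M) (fun y => g x y * tdist t x y) -
          (if Nat.eqb x r then a * sumf (seq 0 M) (fun y => g x y * tdist t x y) else 0))).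
      2:{ intros x Hx; apply Hlt in Hx; rewrite sumf_seq_S, hxM by lia.
          destruct (Nat.eqb_spec x r) as [E|E].
          - rewrite <- sumf_scal, <- sumf_minus, Rmult_0_l, Rplus_0_r.
            apply sumf_ext; intros y Hy; apply Hlt in Hy; rewrite hx by lia.
            destruct (Nat.eqb_spec x r); [lra|congruence].
          - rewrite Rmult_0_l, Rplus_0_r, Rminus_0_r.
            apply sumf_ext; intros y Hy; apply Hlt in Hy; rewrite hx by lia.
            destruct (Nat.eqb_spec x r); [congruence|lra]. }
      rewrite sumf_minus.
      rewrite (sumf_seq_single M r
        (fun x => a * sumf (seq 0 M) (fun y => g x y * tdist t x y))) by lia.
      rewrite sumf_scal, Hsa, <- Hgr.
      (* Going from [M] by way of its parent costs at most [twt t M] more than starting at [r], and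
         the amount that does so is [s]. *)
      assert (sumf (seq 0 M) (fun y => g r y * tdist t M y) <=
        sumf (seq 0 M) (fun y => g r y * twt t M + g r y * tdist t r y)).
      { apply sumf_le; intros y Hy; assert (0 <= g r y) by (apply G1; [apply Hlt; lia|exact Hy]).
        apply Hlt in Hy; pose proof (tdist_par t Hwf M y ltac:(lia) ltac:(lia)) as T.
        fold r in T; nra. }
      rewrite sumf_plus, sumf_scal_r in H; nra. }
    eapply Rle_trans; [exact Hc|]; lra.
Qed.

(** The vertex of highest label is childless among those that remain, so it can be eliminated; by
    symmetry it may be assumed to have a surplus. *)
Lemma vertex_transport M :
  (1 <= M <= tN t)%nat -> forall p q,
  (forall x, (x < M)%nat -> 0 <= p x) -> (forall x, (x < M)%nat -> 0 <= q x) ->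
  sumf (seq 0 M) p = sumf (seq 0 M) q -> transportable M p q.
Proof.
  induction M as [|M IH]; intros HM; [lia|].
  destruct (Nat.eq_dec M 0) as [->|HM0].
  - intros p q Hp Hq E; exists (fun _ _ => p 0%nat).
    unfold coupling_cost, is_coupling; cbn in E |- *; unfold sumf; cbn.
    repeat split.
    + intros; apply Hp; lia.
    + intros x [<-|[]]; lra.
    + intros x [<-|[]]; lra.
    + rewrite tdist_refl by (assumption || lia); lra.
  - assert (Hpush : forall p q,
      (forall x, (x < S M)%nat -> 0 <= p x) -> (forall x, (x < S M)%nat -> 0 <= q x) ->
      sumf (seq 0 (S M)) p = sumf (seq 0 (S M)) q -> q M <= p M -> transportable (S M) p q).
    { intros p q Hp Hq E Hle; pose proof (par_lt t Hwf M ltac:(lia)).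
      apply transportable_push; try lia; try (intros; (apply Hp || apply Hq); lia); try lra.
      apply IH; [lia| | |].
      - intros x Hx; specialize (Hp x ltac:(lia)); destruct (Nat.eqb x (tpar t M)); lra.
      - intros x Hx; apply Hq; lia.
      - rewrite sumf_plus, (sumf_seq_single M (tpar t M) (fun _ => p M - q M)) by lia.
        rewrite !sumf_seq_S in E; lra. }
    intros p q Hp Hq E; destruct (Rle_dec (q M) (p M)) as [Hle|Hlt]; [now apply Hpush|].
    apply transportable_sym, Hpush; auto; lra.
Qed.

Lemma is_leafb_In v : is_leafb t v = true <-> In v (leaves t).
Proof.
  unfold leaves; rewrite filter_In, in_seq; unfold is_leafb at 1 2.
  rewrite andb_true_iff, Nat.ltb_lt; intuition lia.
Qed.

Lemma sumf_leaves f :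
  sumf (leaves t) f = sumf (seq 0 (tN t)) (fun x => if is_leafb t x then f x else 0).
Proof. apply sumf_filter. Qed.

(** Extend both laws by zero to the inner vertices: a nonnegative coupling then vanishes off the
    leaves because its marginals do. *)
Lemma leaf_transport p q :
  distr t p -> distr t q ->
  exists g, is_coupling (leaves t) p q g /\ coupling_cost t (leaves t) g <= emd t p q.
Proof.
  intros (Hp & Ep) (Hq & Eq).
  set (ext := fun (f : nat -> R) x => if is_leafb t x then f x else 0).
  destruct Hwf as (HN & _).
  assert (Hext : forall f, (forall l, In l (leaves t) -> 0 <= f l) ->
    forall x, (x < tN t)%nat -> 0 <= ext f x).
  { intros f Hf x _; unfold ext; destruct (is_leafb t x) eqn:E; [|lra].
    apply Hf; now apply is_leafb_In. }
  destruct (vertex_transport (tN t) ltac:(lia) (ext p) (ext q)) as (g & (G1 & G2 & G3) & G4).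
  { now apply Hext. }
  { now apply Hext. }
  { unfold ext; rewrite <- !sumf_leaves; lra. }
  assert (Hsub : forall x, In x (leaves t) -> In x (seq 0 (tN t))).
  { intros x Hx; apply in_seq; pose proof (leaves_lt t x Hx); lia. }
  assert (Z1 : forall x y, In x (seq 0 (tN t)) -> In y (seq 0 (tN t)) ->
    is_leafb t x = false -> g x y = 0).
  { intros x y Hx Hy E; apply (sumf_eq0 (seq 0 (tN t)) (g x)); auto.
    rewrite G2 by exact Hx; unfold ext; now rewrite E. }
  assert (Z2 : forall x y, In x (seq 0 (tN t)) -> In y (seq 0 (tN t)) ->
    is_leafb t y = false -> g x y = 0).
  { intros x y Hx Hy E; apply (sumf_eq0 (seq 0 (tN t)) (fun x => g x y)); auto.
    rewrite G3 by exact Hy; unfold ext; now rewrite E. }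
  exists g; split; [split; [|split]|].
  - intros; apply G1; auto.
  - intros x Hx; rewrite sumf_leaves; rewrite (sumf_ext _ _ (g x)).
    + rewrite G2 by auto; unfold ext; apply is_leafb_In in Hx; now rewrite Hx.
    + intros y Hy; destruct (is_leafb t y) eqn:E; [reflexivity|symmetry; auto].
  - intros y Hy; rewrite sumf_leaves; rewrite (sumf_ext _ _ (fun x => g x y)).
    + rewrite G3 by auto; unfold ext; apply is_leafb_In in Hy; now rewrite Hy.
    + intros x Hx; destruct (is_leafb t x) eqn:E; [reflexivity|symmetry; auto].
  - eapply Rle_trans; [apply Req_le|eapply Rle_trans; [exact G4|apply Req_le]].
    + unfold coupling_cost; rewrite sumf_leaves; apply sumf_ext; intros x Hx.
      destruct (is_leafb t x) eqn:E.
      * rewrite sumf_leaves; apply sumf_ext; intros y Hy.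
        destruct (is_leafb t y) eqn:E'; [reflexivity|]; rewrite (Z2 x y) by auto; lra.
      * symmetry; apply sumf_0; intros y Hy; rewrite (Z1 x y) by auto; lra.
    + unfold emd; apply sumf_ext; intros v _; do 2 f_equal.
      unfold mass; rewrite !sumf_leaves, <- sumf_minus; apply sumf_ext; intros x _.
      unfold ext; destruct (is_leafb t x); lra.
Qed.

End Transport.

(** * The proximal step *)

(* [response M L]: how the multiplier [L m] of a vertex depends on the multiplier [m] of
   its parent.  Being 1-Lipschitz makes the mass sent down nondecreasing in [m]; the two
   bounds keep all multipliers in [0, M]. *)
Definition response (M : R) (L : R -> R) : Prop :=
  (forall x y, x <= y -> L x <= L y <= L x + (y - x)) /\
  (forall x, x <= 0 -> x <= L x) /\ (forall x, M <= x -> L x <= x).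

(** Models the total mass sent to the children as a function of the multiplier of their parent; the
    last two clauses bracket the point where it equals [A]. *)
Definition inflow (M A : R) (S : R -> R) : Prop :=
  continuity S /\ (forall x y, x <= y -> S x <= S y) /\
  (forall x, x <= 0 -> S x <= A) /\ (forall x, M <= x -> A <= S x).

Lemma exp_le x y : x <= y -> exp x <= exp y.
Proof. intros [H|<-]; [left; now apply exp_increasing|lra]. Qed.

Lemma ln_le x y : 0 < x -> x <= y -> ln x <= ln y.
Proof. intros Hx [H|<-]; [left; now apply ln_increasing|lra]. Qed.

Lemma lipschitz_continuity L :
  (forall x y, x <= y -> L x <= L y <= L x + (y - x)) -> continuity L.
Proof.
  intros H x e He; exists e; split; [exact He|]; intros y [_ Hd].
  simpl in *; unfold Rdist in *.
  destruct (Rle_dec x y) as [Hxy|Hxy].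
  - specialize (H x y Hxy); rewrite Rabs_pos_eq in Hd |- * by lra; lra.
  - specialize (H y x ltac:(lra)).
    rewrite Rabs_minus_sym in Hd |- *; rewrite Rabs_pos_eq in Hd |- * by lra; lra.
Qed.

Lemma continuity_const_fun (a : R) : continuity (fun _ => a).
Proof. apply continuity_const; intros x y; reflexivity. Qed.

Lemma continuity_id_fun : continuity (fun x => x).
Proof. apply derivable_continuous, derivable_id. Qed.

Lemma continuity_exp_scaled A k f :
  continuity f -> continuity (fun x => A * exp (k * f x)).
Proof.
  intros Hf.
  apply (continuity_mult (fun _ => A) (fun x => exp (k * f x)));
    [apply continuity_const_fun|].
  apply (continuity_comp (fun x => k * f x) exp).
  - apply (continuity_mult (fun _ => k) f); [apply continuity_const_fun|exact Hf].
  - apply derivable_continuous, derivable_exp.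
Qed.

(** [x - L x] is nondecreasing because [L] is 1-Lipschitz, and the two bounds on [L] give its sign
    for [x <= 0] and for [M <= x]. *)
Lemma inflow_response M A k L :
  0 < A -> 0 < k -> response M L -> inflow M A (fun x => A * exp (k * (x - L x))).
Proof.
  intros HA Hk (H1 & H2 & H3).
  assert (Hexp : forall x y, x <= y -> A * exp (k * x) <= A * exp (k * y)).
  { intros x y Hxy; apply Rmult_le_compat_l; [lra|]; apply exp_le; nra. }
  assert (H0 : A = A * exp (k * 0)) by (rewrite Rmult_0_r, exp_0; lra).
  split; [|split; [|split]].
  - apply continuity_exp_scaled, (continuity_minus (fun x => x) L);
      [apply continuity_id_fun|now apply lipschitz_continuity].
  - intros x y Hxy; apply Hexp; specialize (H1 x y Hxy); lra.
  - intros x Hx; rewrite H0 at 2; apply Hexp; specialize (H2 x Hx); lra.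
  - intros x Hx; rewrite H0 at 1; apply Hexp; specialize (H3 x Hx); lra.
Qed.

Lemma inflow_sumf M l A S :
  (forall v, In v l -> inflow M (A v) (S v)) ->
  inflow M (sumf l A) (fun x => sumf l (fun v => S v x)).
Proof.
  intros H; split; [|split; [|split]].
  - induction l as [|v l IH]; [apply (continuity_const_fun 0)|].
    apply (continuity_plus (S v) (fun x => sumf l (fun v => S v x))).
    + apply H; now left.
    + apply IH; intros; apply H; now right.
  - intros; apply sumf_le; intros v Hv; now apply H.
  - intros; apply sumf_le; intros v Hv; now apply H.
  - intros; apply sumf_le; intros v Hv; now apply H.
Qed.

Lemma inflow_zero M A S (g : R -> R) lo hi :
  inflow M A S -> continuity g -> lo <= hi ->
  S lo <= g lo -> g hi <= S hi -> exists x, lo <= x <= hi /\ S x = g x.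
Proof.
  intros (HS & _) Hg Hlh Hlo Hhi.
  destruct (IVT_cor (fun x => S x - g x) lo hi) as (x & Hx & E).
  - now apply continuity_minus.
  - exact Hlh.
  - nra.
  - exists x; split; [exact Hx|lra].
Qed.

(** In the unknown [L m] the inflow is nondecreasing and the right side strictly decreasing. The
    intermediate value theorem gives solutions, and comparing two of them gives monotonicity and the
    Lipschitz bound. *)
Lemma response_solution M A k S :
  0 < A -> 0 < k -> 0 <= M -> inflow M A S ->
  exists L, response M L /\ forall m, S (L m) = A * exp (k * (m - L m)).
Proof.
  intros HA Hk HM HS; pose proof HS as (_ & S1 & S2 & S3).
  assert (HAe : forall x, 0 <= x -> A <= A * exp (k * x)).
  { intros x Hx; pose proof (exp_ineq1_le (k * x)); assert (0 <= k * x) by nra; nra. }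
  assert (HAe' : forall x, x <= 0 -> A * exp (k * x) <= A).
  { intros x Hx; assert (exp (k * x) <= exp 0) by (apply exp_le; nra).
    rewrite exp_0 in *; nra. }
  (* At the left end [x <= 0] and [x <= m], at the right end [M <= x] and [m <= x]; at both ends [A]
     separates the two sides. *)
  assert (Hex : forall m, exists x,
    Rmin 0 m <= x <= Rmax M m /\ S x = A * exp (k * (m - x))).
  { intros m; pose proof (Rmin_l 0 m); pose proof (Rmin_r 0 m).
    pose proof (Rmax_l M m); pose proof (Rmax_r M m).
    apply inflow_zero with M A; auto.
    - apply continuity_exp_scaled, (continuity_minus (fun _ => m) (fun x => x));
        [apply continuity_const_fun|apply continuity_id_fun].
    - lra.
    - apply Rle_trans with A; [apply S2|apply HAe]; lra.
    - apply Rle_trans with A; [apply HAe'|apply S3]; lra. }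
  set (L := fun m => proj1_sig (constructive_indefinite_description _ (Hex m))).
  assert (HL : forall m, Rmin 0 m <= L m <= Rmax M m /\ S (L m) = A * exp (k * (m - L m))).
  { intros m; unfold L; exact (proj2_sig (constructive_indefinite_description _ (Hex m))). }
  exists L; split; [split; [|split]|intros; apply HL].
  - intros x y Hxy; destruct (HL x) as [_ Ex], (HL y) as [_ Ey].
    assert (Hlt : forall u v, u < v -> A * exp (k * u) < A * exp (k * v)).
    { intros u v Huv; apply Rmult_lt_compat_l; [exact HA|]; apply exp_increasing; nra. }
    assert (Hm : L x <= L y).
    { apply Rnot_lt_le; intros Hlt'; pose proof (S1 (L y) (L x) ltac:(lra)).
      pose proof (Hlt (x - L x) (y - L y) ltac:(lra)); lra. }
    (* If [L] grew faster than the identity, the right side would strictly drop while the inflow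
       does not. *)
    split; [exact Hm|]; apply Rnot_lt_le; intros Hlt'.
    pose proof (S1 (L x) (L y) Hm); pose proof (Hlt (y - L y) (x - L x) ltac:(lra)); lra.
  - intros x Hx; destruct (HL x) as [[H _] _]; rewrite Rmin_right in H by lra; exact H.
  - intros x Hx; destruct (HL x) as [[_ H] _]; rewrite Rmax_right in H by lra; exact H.
Qed.

(** The multiplier of a leaf is its cost unless the mass would then fall below its floor; [s] is the
    shift that brings the mass exactly to the floor. *)
Lemma response_leaf M c s :
  0 <= c <= M -> 0 <= s -> response M (fun m => Rmin c (m + s)).
Proof.
  intros Hc Hs; split; [|split]; intros.
  - unfold Rmin; destruct (Rle_dec c (x + s)), (Rle_dec c (y + s)); lra.
  - apply Rmin_glb; lra.
  - pose proof (Rmin_l c (x + s)); lra.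
Qed.

(** * Existence of the proximal point *)

Section Prox.

Variable t : wtree.
Hypothesis Hwf : wf_tree t.
Variables kap a dl c : nat -> R.
Hypothesis Hkap : forall v, In v (edges t) -> 0 < kap v.
Hypothesis Ha : forall v, (v < tN t)%nat -> 0 < a v.
Hypothesis Hsum : forall u, (u < tN t)%nat -> ~ In u (leaves t) -> a u = sumf (children t u) a.
Hypothesis Hdl : forall l, In l (leaves t) -> 0 < dl l <= a l.
Hypothesis Hc : forall l, In l (leaves t) -> 0 <= c l.

(** Bounds every leaf cost, and so serves as the common upper bound in all responses. *)
Let M := sumf (leaves t) c.

(** The new mass of [v] when its parent has multiplier [m]. *)
Definition outflow (L : nat -> R -> R) (v : nat) (m : R) : R :=
  a v * exp (kap v * (m - L v m)).

(** The optimality conditions seen from one vertex: complementary slackness at a leaf, conservation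
    of mass elsewhere. *)
Definition balanced (L : nat -> R -> R) (u : nat) : Prop :=
  response M (L u) /\
  (In u (leaves t) -> forall m,
     L u m <= c u /\ dl u <= outflow L u m /\ (outflow L u m = dl u \/ L u m = c u)) /\
  (~ In u (leaves t) -> forall m,
     sumf (children t u) (fun v => outflow L v (L u m)) = outflow L u m).

Lemma M_nonneg : 0 <= M.
Proof. now apply sumf_nonneg. Qed.

Lemma inflow_children L u :
  (u < tN t)%nat -> ~ In u (leaves t) ->
  (forall v, In v (children t u) -> response M (L v)) ->
  inflow M (a u) (fun x => sumf (children t u) (fun v => outflow L v x)).
Proof.
  intros Hu Hl H; rewrite Hsum by assumption; apply inflow_sumf; intros v Hv.
  pose proof Hv as Hv'; apply in_children in Hv' as [Hv' _].
  apply inflow_response; auto; [apply Ha; lia|]; apply Hkap, in_edges; lia.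
Qed.

(** Responses are built from the highest label down, so those of the children are known first. The
    root is left out, having no edge above it. *)
Lemma balanced_exists k :
  exists L, forall u, (0 < u < tN t)%nat -> (tN t <= u + k)%nat -> balanced L u.
Proof.
  induction k as [|k (L & IH)]; [exists (fun _ x => x); intros; lia|].
  destruct (lt_dec 0 (tN t - S k)) as [Hpos|Hpos].
  2:{ exists L; intros; apply IH; lia. }
  set (w := (tN t - S k)%nat) in *.
  assert (Hw : (0 < w < tN t)%nat) by lia.
  assert (Hkw : 0 < kap w) by (apply Hkap, in_edges; exact Hw).
  assert (Haw : 0 < a w) by (apply Ha; lia).
  assert (Hg : exists g, response M g /\
    (In w (leaves t) -> forall m, g m <= c w /\ dl w <= a w * exp (kap w * (m - g m)) /\
       (a w * exp (kap w * (m - g m)) = dl w \/ g m = c w)) /\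
    (~ In w (leaves t) -> forall m,
      sumf (children t w) (fun v => outflow L v (g m)) = a w * exp (kap w * (m - g m)))).
  { destruct (classic (In w (leaves t))) as [Hl|Hl].
    - specialize (Hdl w Hl); specialize (Hc w Hl) as Hcw.
      set (s := (ln (a w) - ln (dl w)) / kap w).
      assert (Hs : 0 <= s).
      { unfold s; apply Rle_mult_inv_pos; [|exact Hkw].
        assert (ln (dl w) <= ln (a w)) by (apply ln_le; lra); lra. }
      assert (Es : a w * exp (kap w * (- s)) = dl w).
      { replace (kap w * (- s)) with (ln (dl w) + - ln (a w)) by (unfold s; field; lra).
        rewrite exp_plus, exp_Ropp, !exp_ln by lra; field; lra. }
      exists (fun m => Rmin (c w) (m + s)); split; [|split].
      + apply response_leaf; [|exact Hs]; split; [exact Hcw|].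
        apply (sumf_ge_term (leaves t) c); assumption.
      + intros _ m; split; [apply Rmin_l|].
        destruct (Rle_dec (c w) (m + s)).
        * rewrite Rmin_left by assumption; split; [|now right].
          rewrite <- Es; apply Rmult_le_compat_l; [lra|]; apply exp_le; nra.
        * rewrite Rmin_right by lra; replace (m - (m + s)) with (- s) by lra.
          rewrite Es; split; [lra|now left].
      + contradiction.
    - destruct (response_solution M (a w) (kap w)
        (fun x => sumf (children t w) (fun v => outflow L v x))) as (g & G1 & G2); auto.
      + apply M_nonneg.
      + apply inflow_children; [lia|exact Hl|]; intros v Hv; apply in_children in Hv as [Hv Hp].
        pose proof (par_lt t Hwf v Hv); apply IH; lia.
      + exists g; split; [exact G1|]; split; [contradiction|]; intros _; exact G2. }
  destruct Hg as (g & G1 & G2 & G3).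
  set (L' := fun u => if Nat.eqb u w then g else L u).
  assert (EL : forall u, u <> w -> L' u = L u).
  { intros u Hu; unfold L'; destruct (Nat.eqb_spec u w); [congruence|reflexivity]. }
  assert (ELw : L' w = g) by (unfold L'; now rewrite Nat.eqb_refl).
  assert (Hch : forall u m, (w <= u < tN t)%nat ->
    sumf (children t u) (fun v => outflow L' v m) = sumf (children t u) (fun v => outflow L v m)).
  { intros u m Hu; apply sumf_ext; intros v Hv; apply in_children in Hv as [Hv Hp].
    pose proof (par_lt t Hwf v Hv); unfold outflow; rewrite EL by lia; reflexivity. }
  exists L'; intros u Hu Huk; destruct (Nat.eq_dec u w) as [->|Hne].
  - assert (Eo : forall m, outflow L' w m = a w * exp (kap w * (m - g m))).
    { intros m; unfold outflow; rewrite ELw; reflexivity. }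
    unfold balanced; rewrite ELw; split; [exact G1|split; intros Hl m].
    + rewrite Eo; now apply G2.
    + rewrite Eo, Hch by lia; now apply G3.
  - destruct (IH u Hu ltac:(lia)) as (B1 & B2 & B3).
    assert (Eo : forall m, outflow L' u m = outflow L u m).
    { intros m; unfold outflow; rewrite EL by exact Hne; reflexivity. }
    unfold balanced; rewrite EL by exact Hne; split; [exact B1|split; intros Hl m].
    + rewrite Eo; now apply B2.
    + rewrite Eo, Hch by lia; now apply B3.
Qed.

(** The optimality conditions are solved directly, without a minimization: responses are composed
    bottom-up, then multipliers are read off top-down. *)
Lemma prox_exists :
  ~ In 0%nat (leaves t) ->
  exists lam b : nat -> R,
    (forall v, (v < tN t)%nat -> 0 <= lam v) /\
    b 0%nat = a 0%nat /\
    (forall v, In v (edges t) -> b v = a v * exp (kap v * (lam (tpar t v) - lam v))) /\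
    (forall u, (u < tN t)%nat -> ~ In u (leaves t) -> b u = sumf (children t u) b) /\
    (forall l, In l (leaves t) -> lam l <= c l /\ dl l <= b l /\ (b l = dl l \/ lam l = c l)).
Proof.
  intros Hroot; destruct (balanced_exists (tN t)) as (L & HL).
  assert (HN : (0 < tN t)%nat) by (destruct Hwf; lia).
  (* The root multiplier is the one free value; it is chosen so that the total mass is preserved. *)
  assert (H0 : exists x, 0 <= x <= M /\
    sumf (children t 0) (fun v => outflow L v x) = a 0%nat).
  { pose proof M_nonneg.
    assert (HI : inflow M (a 0%nat) (fun x => sumf (children t 0) (fun v => outflow L v x))).
    { apply inflow_children; auto; intros v Hv; apply in_children in Hv as [Hv _].
      apply HL; lia. }
    pose proof HI as (_ & _ & I1 & I2).
    apply (inflow_zero M (a 0%nat) _ (fun _ => a 0%nat)) with (1 := HI);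
      [apply continuity_const_fun|lra|apply I1|apply I2]; lra. }
  destruct H0 as (x0 & Hx0 & E0).
  (* Multipliers are evaluated in the order of the labels; those up to [k] are final. *)
  assert (Hlam : forall k, exists lam, lam 0%nat = x0 /\
    forall v, (0 < v <= k)%nat -> (v < tN t)%nat -> lam v = L v (lam (tpar t v))).
  { induction k as [|k (lam & A0 & A1)]; [exists (fun _ => x0); split; [reflexivity|lia]|].
    exists (fun v => if Nat.eqb v (S k) then L v (lam (tpar t v)) else lam v); split.
    - exact A0.
    - intros v Hv Hv'; pose proof (par_lt t Hwf v ltac:(lia)).
      destruct (Nat.eqb_spec (tpar t v) (S k)); [lia|].
      destruct (Nat.eqb_spec v (S k)); [reflexivity|]; apply A1; lia. }
  destruct (Hlam (tN t)) as (lam & A0 & A1); clear Hlam.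
  set (b := fun v => if Nat.eqb v 0 then a 0%nat else outflow L v (lam (tpar t v))).
  assert (Eb : forall v, (0 < v)%nat -> b v = outflow L v (lam (tpar t v))).
  { intros v Hv; unfold b; destruct (Nat.eqb_spec v 0); [lia|reflexivity]. }
  exists lam, b; split; [|split; [reflexivity|split; [|split]]].
  - apply tree_ind; [exact Hwf|lra|].
    intros v Hv _ Hp; rewrite A1 by lia; destruct (HL v Hv ltac:(lia)) as ((R1 & R2 & _) & _).
    specialize (R1 0 _ Hp); specialize (R2 0 ltac:(lra)); lra.
  - intros v Hv; apply in_edges in Hv; rewrite Eb, (A1 v) by lia; reflexivity.
  - intros u Hu Hl.
    rewrite (sumf_ext _ b (fun v => outflow L v (lam u))).
    + destruct (Nat.eq_dec u 0) as [->|Hne]; [rewrite A0; symmetry; exact E0|].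
      rewrite Eb, (A1 u) by lia; symmetry; apply (HL u); [lia|lia|exact Hl].
    + intros v Hv; apply in_children in Hv as [Hv <-]; apply Eb; lia.
  - intros l Hl; assert (l <> 0%nat) by congruence.
    pose proof (leaves_lt t l Hl); rewrite Eb, (A1 l) by lia.
    apply (HL l); [lia|lia|exact Hl].
Qed.

End Prox.

(** * One step of mirror descent *)

(** This is [exp z >= 1 + z] at [z = ln y - ln x], the source of the convexity estimates below. *)
Lemma ln_secant x y : 0 < x -> 0 < y -> x * (ln y - ln x) <= y - x.
Proof.
  intros Hx Hy.
  pose proof (exp_ineq1_le (ln y - ln x)) as H.
  unfold Rminus in H; rewrite exp_plus, exp_Ropp, !exp_ln in H by assumption.
  apply Rmult_le_compat_l with (r := x) in H; [|lra].
  replace (x * (y * / x)) with y in H by (field; lra); lra.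
Qed.

(** The Bregman divergence of the function [x ln x]. *)
Definition psi (s b : R) : R := s * (ln s - ln b) - s + b.

Lemma psi_nonneg s b : 0 < s -> 0 < b -> 0 <= psi s b.
Proof. intros Hs Hb; unfold psi; pose proof (ln_secant s b Hs Hb); lra. Qed.

(** The difference is affine in [ln b], so it is extremal at [b = d] and [b = 1 + d], where the
    secant inequalities apply. *)
Lemma psi_shift d b e :
  0 < d -> d <= b <= 1 + d -> ln (1 + d) - ln d <= e ->
  - e <= psi (1 + d) b - psi d b <= e.
Proof.
  intros Hd Hb He; unfold psi.
  pose proof (ln_secant d (1 + d) Hd ltac:(lra)).
  pose proof (ln_secant (1 + d) d ltac:(lra) Hd).
  assert (ln d <= ln b) by (apply ln_le; lra).
  assert (ln b <= ln (1 + d)) by (apply ln_le; lra).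
  split; lra.
Qed.

(** * Augmented masses, potentials and the effect of a small cost *)

Section Descent.

Variable t : wtree.
Hypothesis Hwf : wf_tree t.

Definition nleaves : R := INR (length (leaves t)).
(** The factor 2 makes [eta] a bound for [ln ((1 + d) / d)] at every [d >= 1 / n]; see
    [ln_fringe]. *)
Definition eta : R := 2 * ln nleaves.
Definition fringe (v : nat) : R := mass t (fun _ => / nleaves) v.
(** The uniform shift keeps every mass away from zero, so that logarithms stay bounded. *)
Definition aug (p : nat -> R) (v : nat) : R := mass t (fun l => p l + / nleaves) v.

Lemma mass_leaf p l : In l (leaves t) -> mass t p l = p l.
Proof.
  intros Hl; unfold mass.
  rewrite (sumf_ext _ _ (fun x => if Nat.eqb x l then p x else 0)).
  - apply sumf_single; [apply NoDup_leaves|exact Hl].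
  - intros x Hx; apply leaves_lt in Hx as Hx'; apply in_leaves in Hl as [Hl Hl'].
    destruct (Nat.eqb_spec x l) as [->|Hne]; [rewrite ancI_refl by assumption; lra|].
    rewrite (ancI_children t Hwf l x) by assumption; rewrite Hl', sumf_nil; lra.
Qed.

Lemma mass_children p u :
  (u < tN t)%nat -> ~ In u (leaves t) -> mass t p u = sumf (children t u) (mass t p).
Proof.
  intros Hu Hl; unfold mass; rewrite sumf_swap; apply sumf_ext; intros l Hl'.
  rewrite (ancI_children t Hwf u l) by (try congruence; auto using leaves_lt).
  now rewrite sumf_scal.
Qed.

Lemma vertex_ind (P : nat -> Prop) :
  (forall l, In l (leaves t) -> P l) ->
  (forall u, (u < tN t)%nat -> ~ In u (leaves t) -> children t u <> [] ->
     (forall v, In v (children t u) -> P v) -> P u) ->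
  forall u, (u < tN t)%nat -> P u.
Proof.
  intros HL HI.
  assert (H : forall k u, (u < tN t)%nat -> (tN t <= u + k)%nat -> P u).
  { induction k as [|k IH]; intros u Hu Hk; [lia|].
    destruct (classic (In u (leaves t))) as [Hl|Hl]; [now apply HL|].
    apply HI; auto.
    - intros E; apply Hl, in_leaves; auto.
    - intros v Hv; apply in_children in Hv as [Hv Hp].
      pose proof (par_lt t Hwf v Hv); apply IH; lia. }
  intros u Hu; apply (H (tN t)); lia.
Qed.

(** Conservation at inner vertices determines all values from those at the leaves; this turns the
    proximal point into the masses of an augmented law. *)
Lemma mass_unique b :
  (forall u, (u < tN t)%nat -> ~ In u (leaves t) -> b u = sumf (children t u) b) ->
  forall u, (u < tN t)%nat -> mass t b u = b u.
Proof.
  intros Hb; apply vertex_ind; [intros; now apply mass_leaf|].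
  intros u Hu Hl _ IH; rewrite mass_children, Hb by assumption.
  apply sumf_ext; exact IH.
Qed.

Lemma mass_ext p q v :
  (forall l, In l (leaves t) -> p l = q l) -> mass t p v = mass t q v.
Proof. intros H; apply sumf_ext; intros l Hl; now rewrite H. Qed.

Lemma mass_root p : mass t p 0 = sumf (leaves t) p.
Proof.
  apply sumf_ext; intros l Hl; rewrite ancI_root by auto using leaves_lt; lra.
Qed.

Lemma aug_split p v : aug p v = mass t p v + fringe v.
Proof.
  unfold aug, fringe, mass; rewrite <- sumf_plus; apply sumf_ext; intros; lra.
Qed.

Lemma ancI_bounds v u : 0 <= ancI t v u <= 1.
Proof. destruct (ancI_01 t v u); lra. Qed.

Lemma mass_bounds p v : distr t p -> 0 <= mass t p v <= 1.
Proof.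
  intros [Hp E]; split.
  - apply sumf_nonneg; intros l Hl; apply Rmult_le_pos; [auto|apply ancI_bounds].
  - rewrite <- E; apply sumf_le; intros l Hl; specialize (Hp l Hl).
    pose proof (ancI_bounds v l); nra.
Qed.

Lemma depth_le_all v : (v < tN t)%nat -> depth t v <= INR (comb_depth t).
Proof.
  revert v; apply vertex_ind; [apply depth_le_comb_depth|].
  intros u Hu _ Hne IH; destruct (children t u) as [|v L] eqn:E; [congruence|].
  assert (Hv : In v (children t u)) by (rewrite E; now left).
  apply in_children in Hv as [Hv Hp]; specialize (IH v ltac:(now left)).
  rewrite depth_S, Hp in IH by assumption; lra.
Qed.

Hypothesis Hn : (2 <= length (leaves t))%nat.

Lemma nleaves_ge2 : 2 <= nleaves.
Proof. unfold nleaves; replace 2 with (INR 2) by (simpl; lra); now apply le_INR. Qed.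

Lemma eta_ge1 : 1 <= eta.
Proof.
  pose proof nleaves_ge2; unfold eta.
  assert (ln 2 <= ln nleaves) by (apply ln_le; lra).
  pose proof (ln_secant 2 1 ltac:(lra) ltac:(lra)) as E; rewrite ln_1 in E; lra.
Qed.

Lemma sumf_uniform : sumf (leaves t) (fun _ => / nleaves) = 1.
Proof.
  rewrite sumf_const; fold nleaves; pose proof nleaves_ge2; apply Rinv_r; lra.
Qed.

Lemma fringe_ge v : (v < tN t)%nat -> / nleaves <= fringe v.
Proof.
  assert (0 < / nleaves) by (apply Rinv_0_lt_compat; pose proof nleaves_ge2; lra).
  revert v; apply vertex_ind.
  - intros l Hl; unfold fringe; rewrite mass_leaf by exact Hl; lra.
  - intros u Hu Hl Hne IH; unfold fringe; rewrite mass_children by assumption.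
    destruct (children t u) as [|v L]; [congruence|].
    eapply Rle_trans; [apply (IH v); now left|].
    apply (sumf_ge_term (v :: L) fringe); [|now left].
    intros x Hx; specialize (IH x Hx); lra.
Qed.

Lemma fringe_pos v : (v < tN t)%nat -> 0 < fringe v.
Proof.
  intros Hv; apply Rlt_le_trans with (/ nleaves); [|now apply fringe_ge].
  apply Rinv_0_lt_compat; pose proof nleaves_ge2; lra.
Qed.

Lemma aug_bounds p v : distr t p -> fringe v <= aug p v <= 1 + fringe v.
Proof. intros Hp; rewrite aug_split; pose proof (mass_bounds p v Hp); lra. Qed.

Lemma aug_pos p v : distr t p -> (v < tN t)%nat -> 0 < aug p v.
Proof. intros Hp Hv; pose proof (fringe_pos v Hv); pose proof (aug_bounds p v Hp); lra. Qed.

Lemma ln_fringe v : (v < tN t)%nat -> ln (1 + fringe v) - ln (fringe v) <= eta.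
Proof.
  intros Hv; pose proof (fringe_pos v Hv); pose proof (fringe_ge v Hv); pose proof nleaves_ge2.
  assert (1 <= fringe v * nleaves).
  { replace 1 with (/ nleaves * nleaves) by (field; lra); apply Rmult_le_compat_r; lra. }
  (* With [d = fringe v], the bounds [d * n >= 1] and [n >= 2] give [1 + d <= d * n^2]. *)
  assert (ln (1 + fringe v) <= ln (fringe v * (nleaves * nleaves))) by (apply ln_le; nra).
  rewrite !ln_mult in * by nra; unfold eta; lra.
Qed.

Lemma leaf_exists : exists l, In l (leaves t).
Proof. destruct (leaves t) as [|l L]; [simpl in Hn; lia|]; exists l; now left. Qed.

Lemma comb_depth_ge1 : 1 <= INR (comb_depth t).
Proof.
  destruct leaf_exists as (l & Hl).
  assert (l <> 0%nat) by (intros ->; exact (root_not_leaf t Hwf Hn Hl)).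
  eapply Rle_trans; [apply (depth_ge1 t Hwf l)|now apply depth_le_comb_depth].
  pose proof (leaves_lt t l Hl); lia.
Qed.

(** Exchange the sums and telescope along the path from the root to each leaf. *)
Lemma sum_by_parts p phi :
  sumf (edges t) (fun v => mass t p v * (phi (tpar t v) - phi v)) =
  sumf (leaves t) p * phi 0%nat - sumf (leaves t) (fun l => p l * phi l).
Proof.
  unfold mass.
  rewrite (sumf_ext (edges t) _ (fun v =>
    sumf (leaves t) (fun l => p l * (ancI t v l * (phi (tpar t v) - phi v)))))
    by (intros v _; rewrite <- sumf_scal_r; apply sumf_ext; intros; lra).
  rewrite sumf_swap, <- sumf_scal_r, <- sumf_minus; apply sumf_ext; intros l Hl.
  rewrite sumf_scal, path_telescope by auto using leaves_lt; lra.
Qed.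

(* Sum by parts against [phi = depth * lam]. *)
Lemma sum_by_depth p lam :
  sumf (edges t) (fun v => mass t p v * lam v) =
  sumf (leaves t) (fun l => p l * (depth t l * lam l)) +
  sumf (edges t) (fun v => (depth t v - 1) * (mass t p v * (lam (tpar t v) - lam v))).
Proof.
  pose proof (sum_by_parts p (fun v => depth t v * lam v)) as E; simpl in E.
  rewrite depth_0, Rmult_0_l, Rmult_0_r in E.
  assert (E' : sumf (edges t) (fun v => mass t p v * lam v) =
    sumf (edges t) (fun v =>
      (depth t v - 1) * (mass t p v * (lam (tpar t v) - lam v)) -
      mass t p v * (depth t (tpar t v) * lam (tpar t v) - depth t v * lam v))).
  { apply sumf_ext; intros v Hv; apply in_edges in Hv; rewrite (depth_S t Hwf v Hv); ring. }
  rewrite E', sumf_minus, E; lra.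
Qed.

Definition inner (c p : nat -> R) : R := sumf (leaves t) (fun l => p l * c l).

Definition bregman (r : nat) (p : nat -> R) : R :=
  sumf (edges t) (fun v => twt t v / eta * psi (ancI t v r + fringe v) (aug p v)).

Definition potW (p : nat -> R) : R := sumf (edges t) (fun v => twt t v * aug p v).
Definition potL (p : nat -> R) : R :=
  sumf (edges t) (fun v => twt t v * (fringe v * ln (aug p v))).
Definition potG (p : nat -> R) : R :=
  sumf (edges t) (fun v => (depth t v - 1) * (twt t v * aug p v)).

(** The coefficients come from chaining three estimates of [small_step]: [HA] is inserted into [HV],
    and the result into [HE]. *)
Definition pot (p : nat -> R) : R :=
  6 * INR (comb_depth t) * (potW p - 2 * potL p) + 2 * potG p + potW p.

(** Let [X] be the drop of the multiplier along an edge. Its pairings with the old masses, the new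
    masses and [fringe] telescope, and the secant bounds tie them to the change of mass. *)
Lemma small_step p c :
  distr t p -> (forall l, In l (leaves t) -> 0 <= c l) ->
  (forall l, In l (leaves t) -> eta / twt t l * c l <= / 3) ->
  exists q, distr t q /\ inner c q <= inner c p /\
    (forall r, In r (leaves t) -> inner c q + bregman r q <= c r + bregman r p) /\
    emd t p q <= 12 * eta * INR (comb_depth t) * inner c q + (pot q - pot p).
Proof.
  intros Hp Hc Hsmall.
  pose proof eta_ge1 as Heta; pose proof nleaves_ge2 as Hn2.
  assert (Hinv : 0 < / nleaves) by (apply Rinv_0_lt_compat; lra).
  set (kap := fun v => eta / twt t v).
  assert (Hkap : forall v, In v (edges t) -> 0 < kap v).
  { intros v Hv; apply Rdiv_lt_0_compat; [lra|now apply wt_pos]. }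
  destruct (prox_exists t Hwf kap (aug p) (fun _ => / nleaves) c)
    as (lam & b & Hlam & Hb0 & Hb & Hbsum & Hbl); auto.
  { intros; now apply aug_pos. }
  { intros; now apply mass_children. }
  { intros l Hl; split; [exact Hinv|]; unfold aug; rewrite mass_leaf by exact Hl.
    pose proof (proj1 Hp l Hl); lra. }
  { now apply root_not_leaf. }
  set (X := fun v => lam (tpar t v) - lam v) in *.
  set (q := fun l => b l - / nleaves).
  assert (Hqb : forall v, (v < tN t)%nat -> aug q v = b v).
  { intros v Hv; rewrite <- (mass_unique b Hbsum v Hv); apply mass_ext.
    intros l _; unfold q; lra. }
  (* The total augmented mass is 2: one unit of probability and one of [fringe]. *)
  assert (Hpsum : sumf (leaves t) (fun l => p l + / nleaves) = 2).
  { rewrite sumf_plus, sumf_uniform, (proj2 Hp); lra. }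
  assert (HN : (0 < tN t)%nat) by (destruct Hwf; lia).
  assert (Hbs : sumf (leaves t) b = 2).
  { rewrite <- mass_root, (mass_unique b Hbsum 0 HN), Hb0; unfold aug; now rewrite mass_root. }
  assert (Hq : distr t q).
  { split.
    - intros l Hl; destruct (Hbl l Hl) as (_ & H & _); unfold q; lra.
    - unfold q; rewrite sumf_minus, sumf_uniform; lra. }
  (* Complementary slackness: [lam l] differs from [c l] only where the new probability is zero. *)
  assert (Hqc : forall l, In l (leaves t) -> q l * lam l = q l * c l).
  { intros l Hl; destruct (Hbl l Hl) as (_ & _ & [E|E]); [|rewrite E; reflexivity].
    unfold q; rewrite E; lra. }
  set (Qs := inner c q); set (Sd := sumf (leaves t) (fun l => / nleaves * lam l)).
  set (A := sumf (leaves t) (fun l => (p l + / nleaves) * lam l)).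
  set (B := sumf (leaves t) (fun l => b l * lam l)).
  assert (HB : B = Qs + Sd).
  { unfold B, Qs, Sd, inner; rewrite <- sumf_plus; apply sumf_ext; intros l Hl.
    rewrite <- Hqc by exact Hl; unfold q; ring. }
  assert (Hedge : forall v, In v (edges t) ->
    0 < twt t v /\ 0 < aug p v /\ 0 < b v /\
    eta * (aug p v * X v) <= twt t v * (b v - aug p v) <= eta * (b v * X v) /\
    twt t v * (ln (b v) - ln (aug p v)) = eta * X v).
  { intros v Hv; pose proof (wt_pos t Hwf v Hv) as Hw; pose proof (edge_lt t v Hv) as Hv'.
    pose proof (aug_pos p v Hp Hv') as Hap; pose proof (aug_pos q v Hq Hv') as Hbp.
    rewrite Hqb in Hbp by exact Hv'.
    assert (El : twt t v * (ln (b v) - ln (aug p v)) = eta * X v).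
    { rewrite Hb by exact Hv; rewrite ln_mult, ln_exp by (assumption || apply exp_pos).
      fold (X v); unfold kap; field; lra. }
    repeat split; auto.
    - pose proof (ln_secant _ _ Hap Hbp); nra.
    - pose proof (ln_secant _ _ Hbp Hap); nra. }
  assert (BPa : sumf (edges t) (fun v => aug p v * X v) = 2 * lam 0%nat - A).
  { unfold aug, X; rewrite sum_by_parts, Hpsum; reflexivity. }
  assert (BPb : sumf (edges t) (fun v => b v * X v) = 2 * lam 0%nat - B).
  { rewrite (sumf_ext _ _ (fun v => mass t b v * X v))
      by (intros v Hv; rewrite mass_unique by auto using edge_lt; reflexivity).
    unfold X; rewrite sum_by_parts, Hbs; reflexivity. }
  assert (BPd : sumf (edges t) (fun v => fringe v * X v) = lam 0%nat - Sd).
  { unfold fringe, X; rewrite sum_by_parts, sumf_uniform; unfold Sd; lra. }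
  assert (EW : potW q - potW p = sumf (edges t) (fun v => twt t v * (b v - aug p v))).
  { unfold potW; rewrite <- sumf_minus; apply sumf_ext; intros v Hv.
    rewrite Hqb by (now apply edge_lt); ring. }
  assert (EL : potL q - potL p = eta * (lam 0%nat - Sd)).
  { rewrite <- BPd, <- sumf_scal; unfold potL; rewrite <- sumf_minus.
    apply sumf_ext; intros v Hv; rewrite Hqb by (now apply edge_lt).
    destruct (Hedge v Hv) as (_ & _ & _ & _ & E).
    replace (eta * (fringe v * X v)) with (fringe v * (eta * X v)) by ring.
    rewrite <- E; ring. }
  assert (EG : potG q - potG p =
    sumf (edges t) (fun v => (depth t v - 1) * (twt t v * (b v - aug p v)))).
  { unfold potG; rewrite <- sumf_minus; apply sumf_ext; intros v Hv.
    rewrite Hqb by (now apply edge_lt); ring. }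
  assert (IW : eta * (2 * lam 0%nat - A) <= potW q - potW p <= eta * (2 * lam 0%nat - B)).
  { rewrite EW, <- BPa, <- BPb, <- !sumf_scal; split; apply sumf_le; intros v Hv;
      now apply Hedge. }
  exists q; split; [exact Hq|split; [|split]].
  (* [IW] gives [B <= A], and the contribution [Sd] of the fringe cancels. *)
  - assert (B <= A) by nra.
    assert (A <= inner c p + Sd).
    { unfold A, inner, Sd; rewrite <- sumf_plus; apply sumf_le; intros l Hl.
      destruct (Hbl l Hl) as (H1 & _); pose proof (proj1 Hp l Hl); nra. }
    fold Qs; lra.
  - intros r Hr; fold Qs; destruct (Hbl r Hr) as (Hlr & _).
    assert (E : bregman r q - bregman r p =
      - (lam 0%nat - lam r) - (lam 0%nat - Sd) + / eta * (potW q - potW p)).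
    { rewrite EW, <- BPd, <- (path_telescope t Hwf lam r) by auto using leaves_lt.
      rewrite <- sumf_scal; unfold bregman.
      rewrite <- sumf_minus.
      replace (- sumf (edges t) (fun v => ancI t v r * (lam (tpar t v) - lam v)))
        with ((-1) * sumf (edges t) (fun v => ancI t v r * (lam (tpar t v) - lam v))) by ring.
      rewrite <- sumf_scal, <- sumf_minus, <- sumf_plus; apply sumf_ext; intros v Hv.
      rewrite Hqb by (now apply edge_lt); destruct (Hedge v Hv) as (_ & _ & _ & _ & El).
      fold (X v); unfold psi.
      assert (EX : X v = / eta * (twt t v * (ln (b v) - ln (aug p v))))
        by (rewrite El; field; lra).
      rewrite EX; field; lra. }
    assert (/ eta * (potW q - potW p) <= 2 * lam 0%nat - B).
    { apply Rmult_le_reg_l with eta; [lra|].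
      rewrite <- Rmult_assoc, Rinv_r, Rmult_1_l by lra; apply IW. }
    lra.
  - fold Qs.
    (* As [lam l <= c l], the exponent at a leaf is at least -1/3, and [exp z >= 1 + z] preserves
       two thirds of its augmented mass. *)
    assert (HAB : A <= 3 / 2 * B).
    { unfold A, B; rewrite <- sumf_scal; apply sumf_le; intros l Hl.
      pose proof (leaves_lt t l Hl) as Hl'.
      assert (Hle : In l (edges t)).
      { apply in_edges; assert (l <> 0%nat); [|lia].
        intros ->; exact (root_not_leaf t Hwf Hn Hl). }
      pose proof (Hlam l Hl'); destruct (Hbl l Hl) as (H1 & _).
      pose proof (par_lt t Hwf l (proj1 (in_edges t l) Hle)).
      pose proof (Hlam (tpar t l) ltac:(lia)).
      assert (Ea : aug p l = p l + / nleaves)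
        by (unfold aug; rewrite mass_leaf by exact Hl; reflexivity).
      pose proof (Hb l Hle) as Eb; rewrite Ea in Eb.
      pose proof (exp_ineq1_le (kap l * X l)) as He; pose proof (Hkap l Hle).
      specialize (Hsmall l Hl); fold (kap l) in Hsmall.
      pose proof (proj1 Hp l Hl).
      assert (- / 3 <= kap l * X l) by (unfold X; nra).
      assert (2 / 3 * (p l + / nleaves) <= b l) by (rewrite Eb; fold (X l); nra).
      nra. }
    set (DD := INR (comb_depth t)).
    assert (HDD : 1 <= DD) by apply comb_depth_ge1.
    (* [IW] and [EL] bound [eta * (2 * Sd - A)] by the change of [potW - 2 * potL]. With [HAB] and
       [HB] this eliminates [Sd], leaving [A] on the right with factor 3/4 only. *)
    assert (HA : eta * A <= 6 * eta * Qs + 3 * ((potW q - potW p) - 2 * (potL q - potL p))) by nra.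
    assert (HV : eta * sumf (edges t) (fun v => aug p v * lam v) <=
      DD * (eta * A) + (potG q - potG p)).
    { unfold aug at 1; rewrite sum_by_depth, Rmult_plus_distr_l.
      apply Rplus_le_compat.
      - replace (DD * (eta * A)) with (eta * (DD * A)) by ring.
        apply Rmult_le_compat_l; [lra|]; unfold A; rewrite <- sumf_scal; apply sumf_le.
        intros l Hl; pose proof (proj1 Hp l Hl); pose proof (Hlam l (leaves_lt t l Hl)).
        pose proof (depth_le_comb_depth t l Hl) as Hd; fold DD in Hd.
        assert (0 <= (p l + / nleaves) * lam l) by nra; nra.
      - rewrite EG, <- sumf_scal; apply sumf_le; intros v Hv.
        destruct (Hedge v Hv) as (_ & _ & _ & [H _] & _).
        pose proof (depth_ge1 t Hwf v (proj1 (in_edges t v) Hv)).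
        fold (aug p v); fold (X v); nra. }
    (* On each edge [|a - b| = (b - a) + 2 * max 0 (a - b)]. The signed part goes to [potW]; the
       weighted loss is at most [eta * a * lam v], multipliers being nonnegative. *)
    assert (HE : emd t p q <=
      2 * (eta * sumf (edges t) (fun v => aug p v * lam v)) + (potW q - potW p)).
    { rewrite EW, <- !sumf_scal, <- sumf_plus; unfold emd; apply sumf_le; intros v Hv.
      pose proof (edge_lt t v Hv) as Hv'.
      replace (mass t p v - mass t q v) with (aug p v - b v)
        by (rewrite <- Hqb, !aug_split by exact Hv'; ring).
      destruct (Hedge v Hv) as (Hw & Hap & _ & [H _] & _).
      pose proof (par_lt t Hwf v (proj1 (in_edges t v) Hv)).
      pose proof (Hlam v Hv'); pose proof (Hlam (tpar t v) ltac:(lia)).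
      assert (0 <= eta * (aug p v * lam v)) by (apply Rmult_le_pos; nra).
      assert (0 <= eta * (aug p v * lam (tpar t v))) by (apply Rmult_le_pos; nra).
      unfold X in H; unfold Rabs; destruct (Rcase_abs (aug p v - b v)); lra. }
    unfold pot; fold DD; nra.
Qed.

End Descent.

(** * The algorithm *)

Definition point (r l : nat) : R := if Nat.eqb l r then 1 else 0.

Section Algorithm.

Variable t : wtree.
Hypothesis Hwf : wf_tree t.
Hypothesis Hn : (2 <= length (leaves t))%nat.

Lemma sumf_point r f :
  In r (leaves t) -> sumf (leaves t) (fun l => point r l * f l) = f r.
Proof.
  intros Hr; rewrite <- (sumf_single (leaves t) r f (NoDup_leaves t) Hr).
  apply sumf_ext; intros l _; unfold point; destruct (Nat.eqb l r); lra.
Qed.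

Lemma distr_point r : In r (leaves t) -> distr t (point r).
Proof.
  intros Hr; split.
  - intros l _; unfold point; destruct (Nat.eqb l r); lra.
  - rewrite <- (sumf_point r (fun _ => 1) Hr); apply sumf_ext; intros; lra.
Qed.

Lemma emd_triangle p q r : emd t p r <= emd t p q + emd t q r.
Proof.
  unfold emd; rewrite <- sumf_plus; apply sumf_le; intros v Hv.
  pose proof (wt_pos t Hwf v Hv).
  pose proof (Rabs_triang (mass t p v - mass t q v) (mass t q v - mass t r v)) as T.
  replace (mass t p v - mass t q v + (mass t q v - mass t r v))
    with (mass t p v - mass t r v) in T by ring; nra.
Qed.

Lemma emd_refl p : emd t p p = 0.
Proof. apply sumf_0; intros; rewrite Rminus_diag, Rabs_R0; ring. Qed.

(** From a point mass the only coupling costs the mean distance to [r]; edge by edge the bound is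
    the triangle inequality. *)
Lemma emd_point_le_diam r q : In r (leaves t) -> distr t q -> emd t (point r) q <= diamX t.
Proof.
  intros Hr [Hq Eq].
  apply Rle_trans with (sumf (leaves t) (fun l => q l * tdist t r l)).
  - rewrite (sumf_ext (leaves t) _ (fun l =>
      sumf (edges t) (fun v => twt t v * (q l * Rabs (ancI t v r - ancI t v l)))))
      by (intros l Hl; rewrite tdist_sum, <- sumf_scal by auto using leaves_lt;
          apply sumf_ext; intros; ring).
    rewrite sumf_swap; apply sumf_le; intros v Hv; pose proof (wt_pos t Hwf v Hv).
    rewrite sumf_scal; apply Rmult_le_compat_l; [lra|].
    replace (mass t (point r) v - mass t q v)
      with (sumf (leaves t) (fun l => q l * (ancI t v r - ancI t v l))).
    + eapply Rle_trans; [apply sumf_abs|]; apply Req_le, sumf_ext; intros l Hl.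
      rewrite Rabs_mult, (Rabs_pos_eq (q l)) by auto; reflexivity.
    + unfold mass; rewrite (sumf_point r (ancI t v) Hr).
      rewrite (sumf_ext _ _ (fun l => q l * ancI t v r - q l * ancI t v l)) by (intros; ring).
      rewrite sumf_minus, sumf_scal_r, Eq; ring.
  - replace (diamX t) with (sumf (leaves t) (fun l => q l * diamX t))
      by (rewrite sumf_scal_r, Eq; ring).
    apply sumf_le; intros l Hl; apply Rmult_le_compat_l; [auto|now apply tdist_le_diam].
Qed.

(** * Bounds for the divergence and the potentials *)

Lemma bregman_nonneg r p : distr t p -> 0 <= bregman t r p.
Proof.
  intros Hp; pose proof (eta_ge1 t Hn); apply sumf_nonneg; intros v Hv.
  pose proof (wt_pos t Hwf v Hv); pose proof (edge_lt t v Hv) as Hv'.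
  apply Rmult_le_pos; [apply Rlt_le, Rdiv_lt_0_compat; lra|].
  apply psi_nonneg; [|now apply aug_pos].
  pose proof (fringe_pos t Hwf Hn v Hv'); pose proof (ancI_bounds t v r); lra.
Qed.

Lemma bregman_point r : In r (leaves t) -> bregman t r (point r) = 0.
Proof.
  intros Hr; apply sumf_0; intros v _; rewrite aug_split.
  unfold mass; rewrite (sumf_point r (ancI t v) Hr); unfold psi; ring.
Qed.

(** Only edges separating [r] and [x] contribute a change, each at most [twt t v / eta] times [eta]
    by [psi_shift] and [ln_fringe]. This pays for offline movement. *)
Lemma bregman_lipschitz r x p :
  In r (leaves t) -> In x (leaves t) -> distr t p ->
  bregman t x p <= bregman t r p + tdist t r x.
Proof.
  intros Hr Hx Hp; pose proof (eta_ge1 t Hn) as He.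
  rewrite tdist_sum by auto using leaves_lt.
  unfold bregman; rewrite <- sumf_plus; apply sumf_le; intros v Hv.
  pose proof (wt_pos t Hwf v Hv) as Hw; pose proof (edge_lt t v Hv) as Hv'.
  pose proof (psi_shift _ _ _ (fringe_pos t Hwf Hn v Hv') (aug_bounds t p v Hp)
    (ln_fringe t Hwf Hn v Hv')) as H.
  set (k := twt t v / eta t).
  assert (Hk : 0 < k) by (apply Rdiv_lt_0_compat; lra).
  assert (Ek : twt t v = k * eta t) by (unfold k; field; lra).
  rewrite Ek.
  destruct (ancI_01 t v r) as [->| ->], (ancI_01 t v x) as [->| ->];
    rewrite ?Rplus_0_l, ?Rminus_diag, ?Rabs_R0, ?Rminus_0_r, ?Rminus_0_l, ?Rabs_Ropp, ?Rabs_R1;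
    nra.
Qed.

(** [potW] and [potL] change by at most the transport cost, [potG] by at most [D] times it; since
    [D >= 1], the total is [6 * D * 3 + 2 * D + 1 <= 21 * D]. *)
Lemma pot_diff p q :
  distr t p -> distr t q -> pot t q - pot t p <= 21 * INR (comb_depth t) * emd t p q.
Proof.
  intros Hp Hq; pose proof (comb_depth_ge1 t Hwf Hn) as HD.
  assert (Ed : forall v, aug t q v - aug t p v = - (mass t p v - mass t q v))
    by (intros; rewrite !aug_split; ring).
  assert (Hd : forall v, Rabs (aug t q v - aug t p v) = Rabs (mass t p v - mass t q v))
    by (intros; rewrite Ed; apply Rabs_Ropp).
  assert (HW : potW t q - potW t p <= emd t p q).
  { unfold potW, emd; rewrite <- sumf_minus; apply sumf_le; intros v Hv.
    pose proof (wt_pos t Hwf v Hv); rewrite <- Hd.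
    pose proof (Rle_abs (aug t q v - aug t p v)); nra. }
  assert (HL : potL t p - potL t q <= emd t p q).
  { unfold potL, emd; rewrite <- sumf_minus; apply sumf_le; intros v Hv.
    pose proof (wt_pos t Hwf v Hv); pose proof (edge_lt t v Hv) as Hv'; rewrite <- Hd.
    pose proof (aug_bounds t q v Hq); pose proof (fringe_pos t Hwf Hn v Hv').
    pose proof (aug_pos t Hwf Hn p v Hp Hv'); pose proof (aug_pos t Hwf Hn q v Hq Hv').
    rewrite <- Rmult_minus_distr_l; apply Rmult_le_compat_l; [lra|].
    (* [fringe v * ln x] has slope at most 1 for [x >= fringe v]. *)
    destruct (Rle_dec (aug t p v) (aug t q v)) as [Hle|Hgt].
    - assert (ln (aug t p v) <= ln (aug t q v)) by (apply ln_le; lra).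
      pose proof (Rabs_pos (aug t q v - aug t p v)); nra.
    - rewrite Rabs_minus_sym, Rabs_pos_eq by lra.
      pose proof (ln_secant (aug t q v) (aug t p v) ltac:(lra) ltac:(lra)).
      assert (ln (aug t q v) <= ln (aug t p v)) by (apply ln_le; lra); nra. }
  assert (HG : potG t q - potG t p <= INR (comb_depth t) * emd t p q).
  { unfold potG, emd; rewrite <- sumf_minus, <- sumf_scal; apply sumf_le; intros v Hv.
    pose proof (wt_pos t Hwf v Hv); pose proof (edge_lt t v Hv) as Hv'; rewrite <- Hd.
    pose proof (depth_ge1 t Hwf v (proj1 (in_edges t v) Hv)).
    pose proof (depth_le_all t Hwf v Hv').
    pose proof (Rle_abs (aug t q v - aug t p v)).
    pose proof (Rabs_pos (aug t q v - aug t p v)).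
    set (y := Rabs (aug t q v - aug t p v)) in *.
    replace ((depth t v - 1) * (twt t v * aug t q v) - (depth t v - 1) * (twt t v * aug t p v))
      with ((depth t v - 1) * (twt t v * (aug t q v - aug t p v))) by ring.
    assert (twt t v * (aug t q v - aug t p v) <= twt t v * y) by nra.
    assert (0 <= twt t v * y) by nra; nra. }
  assert (0 <= emd t p q).
  { apply sumf_nonneg; intros v Hv; apply Rmult_le_pos;
      [apply Rlt_le; now apply wt_pos|apply Rabs_pos]. }
  unfold pot; nra.
Qed.

(* [s] is the sum over the parts of a cost [c] of the service costs (see [step_exists]). *)
Definition good_step (c p q : nat -> R) (s : R) : Prop :=
  distr t q /\ inner t c q <= s /\
  (forall r, In r (leaves t) -> s + bregman t r q <= c r + bregman t r p) /\
  emd t p q <= 12 * eta t * INR (comb_depth t) * s + (pot t q - pot t p).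

(* Splitting [c] into equal parts makes each part small enough for [small_step];
   the service cost at the end is at most the average one, because it decreases. *)
Lemma step_exists c p :
  distr t p -> (forall l, In l (leaves t) -> 0 <= c l) -> exists q s, good_step c p q s.
Proof.
  intros Hp Hc; pose proof (eta_ge1 t Hn) as He.
  assert (Hw : forall l, In l (leaves t) -> 0 <= eta t / twt t l * c l).
  { intros l Hl; apply Rmult_le_pos; [|auto].
    apply Rlt_le, Rdiv_lt_0_compat; [lra|]; apply wt_pos; [exact Hwf|].
    apply in_edges; pose proof (leaves_lt t l Hl); assert (l <> 0%nat); [|lia].
    intros ->; exact (root_not_leaf t Hwf Hn Hl). }
  set (U := sumf (leaves t) (fun l => eta t / twt t l * c l)).
  assert (HU : 0 <= U) by now apply sumf_nonneg.
  (* More than [3 * U] parts bring every scaled leaf cost down to at most 1/3. *)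
  destruct (INR_unbounded (3 * U)) as (m & Hm).
  assert (Hm0 : 0 < INR m) by lra.
  assert (Hmi : 0 < / INR m) by now apply Rinv_0_lt_compat.
  set (c' := fun l => / INR m * c l).
  assert (Hc' : forall l, In l (leaves t) -> 0 <= c' l).
  { intros l Hl; apply Rmult_le_pos; [lra|auto]. }
  assert (Hsmall : forall l, In l (leaves t) -> eta t / twt t l * c' l <= / 3).
  { intros l Hl; pose proof (sumf_ge_term _ _ l Hw Hl) as H; fold U in H; cbv beta in H.
    unfold c'; replace (eta t / twt t l * (/ INR m * c l))
      with (/ INR m * (eta t / twt t l * c l)) by ring.
    apply Rmult_le_reg_l with (INR m); [lra|].
    rewrite <- Rmult_assoc, Rinv_r, Rmult_1_l by lra; lra. }
  (* [s] adds up the service costs of the first [k] parts, none of which is below the current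
     one. *)
  assert (Hiter : forall k, exists q s, distr t q /\ INR k * inner t c' q <= s /\
    (forall r, In r (leaves t) -> s + bregman t r q <= INR k * c' r + bregman t r p) /\
    emd t p q <= 12 * eta t * INR (comb_depth t) * s + (pot t q - pot t p)).
  { induction k as [|k (q & s & H1 & H2 & H3 & H4)].
    - exists p, 0; simpl INR; rewrite emd_refl.
      split; [exact Hp|split; [lra|split; [intros; lra|lra]]].
    - destruct (small_step t Hwf Hn q c' H1 Hc' Hsmall) as (q' & I1 & I2 & I3 & I4).
      exists q', (s + inner t c' q'); rewrite S_INR; split; [exact I1|split; [|split]].
      + pose proof (pos_INR k); nra.
      + intros r Hr; specialize (H3 r Hr); specialize (I3 r Hr); lra.
      + pose proof (emd_triangle p q q'); lra. }
  destruct (Hiter m) as (q & s & H1 & H2 & H3 & H4).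
  assert (E : forall r, INR m * c' r = c r) by (intros; unfold c'; field; lra).
  exists q, s; split; [exact H1|split; [|split; [|exact H4]]].
  - eapply Rle_trans; [|exact H2]; unfold inner; rewrite <- sumf_scal.
    apply Req_le, sumf_ext; intros l _; rewrite <- (E l); ring.
  - intros r Hr; specialize (H3 r Hr); rewrite E in H3; exact H3.
Qed.

(** * From laws to a randomized process *)

Definition next (p c : nat -> R) : nat -> R :=
  epsilon (inhabits p) (fun q => exists s, good_step c p q s).

Lemma next_spec p c :
  distr t p -> (forall l, In l (leaves t) -> 0 <= c l) -> exists s, good_step c p (next p c) s.
Proof.
  intros Hp Hc.
  exact (epsilon_spec (inhabits p) (fun q => exists s, good_step c p q s) (step_exists c p Hp Hc)).
Qed.

Definition state (r : nat) (cs : list costfun) : nat -> R := fold_left next cs (point r).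

(** Each row is a law for arbitrary [p] and [q], because [valid_alg] ranges over all costs and
    histories; transport is demanded only between laws. *)
Definition realizes (p q : nat -> R) (K : nat -> nat -> R) : Prop :=
  (forall x, distr t (K x)) /\
  (distr t p -> distr t q ->
    (forall y, In y (leaves t) -> sumf (leaves t) (fun x => p x * K x y) = q y) /\
    sumf (leaves t) (fun x => sumf (leaves t) (fun y => p x * K x y * tdist t x y)) <= emd t p q).

Lemma kernel_exists p q : exists K, realizes p q K.
Proof.
  destruct (leaf_exists t Hn) as (l0 & Hl0).
  destruct (classic (distr t p /\ distr t q)) as [[Hp Hq]|Hpq].
  2:{ exists (fun _ => point l0); split; [intros; now apply distr_point|tauto]. }
  destruct (leaf_transport t Hwf p q Hp Hq) as (g & (G1 & G2 & G3) & G4).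
  (* The conditional law of the target given the source [x]; elsewhere a dummy point mass keeps the
     row a law. *)
  set (K := fun x y => if excluded_middle_informative (In x (leaves t) /\ 0 < p x)
                       then g x y / p x else point l0 y).
  assert (EK : forall x y, In x (leaves t) -> In y (leaves t) -> p x * K x y = g x y).
  { intros x y Hx Hy; unfold K; destruct (excluded_middle_informative _) as [[_ H]|H].
    - field; lra.
    - assert (p x = 0).
      { destruct (Rtotal_order (p x) 0) as [H'|[H'|H']]; auto.
        - pose proof (proj1 Hp x Hx); lra.
        - tauto. }
      rewrite (sumf_eq0 (leaves t) (g x)); [rewrite H0; ring|auto|rewrite G2; auto|exact Hy]. }
  exists K; split.
  - intros x; unfold K; destruct (excluded_middle_informative _) as [[Hx H]|_];
      [|now apply distr_point].
    split.
    + intros y Hy; apply Rle_mult_inv_pos; [now apply G1|exact H].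
    + unfold Rdiv; rewrite sumf_scal_r, G2 by exact Hx; field; lra.
  - intros _ _; split.
    + intros y Hy; rewrite <- G3 by exact Hy; apply sumf_ext; intros x Hx; now apply EK.
    + eapply Rle_trans; [|exact G4]; apply Req_le; unfold coupling_cost.
      apply sumf_ext; intros x Hx; apply sumf_ext; intros y Hy; rewrite EK by assumption; ring.
Qed.

Definition kernel (p q : nat -> R) : nat -> nat -> R :=
  epsilon (inhabits (fun _ => p)) (realizes p q).

Lemma kernel_spec p q : realizes p q (kernel p q).
Proof. exact (epsilon_spec _ (realizes p q) (kernel_exists p q)). Qed.

(** The laws before and after the latest cost are recomputed from the costs and the initial state,
    which is the head of [hist]; the present state is its last entry. *)
Definition mirror_alg : online_alg := fun cs hist =>
  kernel (state (hd 0%nat hist) (removelast cs)) (state (hd 0%nat hist) cs) (last hist 0%nat).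

Lemma mirror_alg_valid : valid_alg t mirror_alg.
Proof. intros cs hist; apply kernel_spec. Qed.

Lemma state_snoc r cs c : state r (cs ++ [c]) = next (state r cs) c.
Proof. unfold state; rewrite fold_left_app; reflexivity. Qed.

Lemma mirror_alg_snoc cs c h :
  mirror_alg (cs ++ [c]) h =
  kernel (state (hd 0%nat h) cs) (state (hd 0%nat h) (cs ++ [c])) (last h 0%nat).
Proof. unfold mirror_alg; now rewrite removelast_last. Qed.

(** For a fixed initial state the process is Markov: only the first and last entries of the history
    matter. *)
Lemma expect_hist f cs : forall cd h h',
  h <> [] -> h' <> [] -> hd 0%nat h = hd 0%nat h' -> last h 0%nat = last h' 0%nat ->
  expect t mirror_alg f cd h cs = expect t mirror_alg f cd h' cs.
Proof.
  induction cs as [|c cs IH]; intros cd h h' Hh Hh' E1 E2; [reflexivity|]; simpl.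
  apply sumf_ext; intros x _; rewrite !mirror_alg_snoc, E1, E2; do 2 f_equal.
  apply IH; try (intros E; apply app_eq_nil in E as [_ E]; discriminate).
  - destruct h, h'; simpl in *; congruence.
  - now rewrite !last_last.
Qed.

(** Expected remaining cost when the present state has law [state r cd]; by [expect_hist], [[r; x]]
    represents every history from [r] to [x]. *)
Definition value (f : costfun -> nat -> nat -> R) (r : nat) (cd cs : list costfun) : R :=
  sumf (leaves t) (fun x => state r cd x * expect t mirror_alg f cd [r; x] cs).

(** The initial law is a point mass, and [[r]] and [[r; r]] share their first and last entries. *)
Lemma expect_start f r cs :
  In r (leaves t) -> expect t mirror_alg f [] [r] cs = value f r [] cs.
Proof.
  intros Hr; unfold value, state; simpl fold_left.
  rewrite (sumf_point r (fun x => expect t mirror_alg f [] [r; x] cs) Hr).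
  apply expect_hist; simpl; congruence.
Qed.

(** The kernel carries the law before [c] to the law after it, so the expected remainders recombine
    into [value]. *)
Lemma value_cons f r cd c cs :
  distr t (state r cd) -> distr t (state r (cd ++ [c])) ->
  value f r cd (c :: cs) =
  sumf (leaves t) (fun x => sumf (leaves t) (fun y =>
    state r cd x * kernel (state r cd) (state r (cd ++ [c])) x y * f c x y)) +
  value f r (cd ++ [c]) cs.
Proof.
  intros Hp Hq; destruct (kernel_spec (state r cd) (state r (cd ++ [c]))) as (_ & H).
  destruct (H Hp Hq) as [Hm _]; clear H.
  set (p := state r cd) in *; set (q := state r (cd ++ [c])) in *; set (K := kernel p q) in *.
  set (V := fun y => expect t mirror_alg f (cd ++ [c]) [r; y] cs).
  assert (E : value f r cd (c :: cs) = sumf (leaves t) (fun x =>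
    sumf (leaves t) (fun y => p x * K x y * f c x y) +
    sumf (leaves t) (fun y => p x * K x y * V y))).
  { unfold value; apply sumf_ext; intros x _; fold p; rewrite <- sumf_plus.
    simpl expect; fold (sumf (leaves t) (fun y => mirror_alg (cd ++ [c]) [r; x] y *
      (f c x y + expect t mirror_alg f (cd ++ [c]) [r; x; y] cs))).
    rewrite <- sumf_scal; apply sumf_ext; intros y _.
    rewrite mirror_alg_snoc; simpl hd; simpl last; fold p q; fold K.
    rewrite (expect_hist f cs (cd ++ [c]) [r; x; y] [r; y]) by (reflexivity || discriminate).
    fold (V y); ring. }
  rewrite E, sumf_plus; f_equal.
  rewrite sumf_swap; unfold value; apply sumf_ext; intros y Hy.
  rewrite sumf_scal_r, Hm by exact Hy; reflexivity.
Qed.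

(** * Accumulated bounds over a cost sequence *)

Definition f_service (c : costfun) (_ x : nat) : R := c x.
Definition f_movement (_ : costfun) (p x : nat) : R := tdist t p x.

(** The divergence from the current offline state is the potential: an offline move from [x] to [y]
    raises it by at most the distance, and serving the cost at [y] is covered by [good_step]. The
    movement potentials telescope up to the final law [p]. *)
Lemma run_bound r cs : forall cd,
  distr t (state r cd) -> valid_costs t cs ->
  exists s p, distr t p /\ 0 <= s /\
    value f_service r cd cs <= s /\
    (forall x xs, In x (leaves t) -> In xs (seqs (leaves t) (length cs)) ->
       s <= path_cost t x cs xs + bregman t x (state r cd)) /\
    value f_movement r cd cs <=
      12 * eta t * INR (comb_depth t) * s + (pot t p - pot t (state r cd)).
Proof.
  induction cs as [|c cs IH]; intros cd Hcd Hv.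
  - exists 0, (state r cd); unfold value; simpl expect.
    rewrite sumf_0 by (intros; ring).
    split; [exact Hcd|split; [lra|split; [lra|split; [|lra]]]].
    intros x xs _ _; simpl; pose proof (bregman_nonneg x _ Hcd); lra.
  - assert (Hc : forall l, In l (leaves t) -> 0 <= c l)
      by (intros l Hl; apply Hv; [now left|exact Hl]).
    destruct (next_spec _ c Hcd Hc) as (s1 & S1 & S2 & S3 & S4).
    rewrite <- state_snoc in S1, S2, S3, S4.
    destruct (IH (cd ++ [c]) S1) as (s2 & p & P1 & P2 & P3 & P4 & P5).
    { intros c' x Hc' Hx; apply Hv; [now right|exact Hx]. }
    destruct (kernel_spec (state r cd) (state r (cd ++ [c]))) as (_ & H).
    destruct (H Hcd S1) as [Hm Hmove]; clear H.
    assert (0 <= inner t c (state r (cd ++ [c]))).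
    { apply sumf_nonneg; intros l Hl; apply Rmult_le_pos; [now apply S1|auto]. }
    exists (s1 + s2), p; split; [exact P1|split; [lra|split; [|split]]].
    + rewrite value_cons by assumption; apply Rplus_le_compat; [|exact P3].
      eapply Rle_trans; [|exact S2]; apply Req_le; rewrite sumf_swap.
      unfold inner; apply sumf_ext; intros y Hy; unfold f_service.
      rewrite sumf_scal_r, Hm by exact Hy; reflexivity.
    + intros x xs Hx Hxs; simpl in Hxs; apply in_flat_map in Hxs as (y & Hy & Hxs).
      apply in_map_iff in Hxs as (ys & <- & Hys); simpl path_cost.
      specialize (P4 y ys Hy Hys); specialize (S3 y Hy).
      pose proof (bregman_lipschitz x y _ Hx Hy Hcd); lra.
    + rewrite value_cons by assumption; unfold f_movement at 1; lra.
Qed.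

Lemma opt_cost_ge s r cs :
  (forall xs, In xs (seqs (leaves t) (length cs)) -> s <= path_cost t r cs xs) ->
  s <= opt_cost t r cs.
Proof.
  intros H.
  (* Leaves exist, hence so do state sequences, and the default value 0 in [opt_cost] does not
     arise. *)
  assert (Hne : exists xs, In xs (seqs (leaves t) (length cs))).
  { destruct (leaf_exists t Hn) as (l & Hl); generalize (length cs) as k.
    induction k as [|k (xs & IH)]; [exists []; now left|].
    exists (l :: xs); simpl; apply in_flat_map; exists l; split; [exact Hl|]; now apply in_map. }
  assert (Hall : forall x, In x (map (path_cost t r cs) (seqs (leaves t) (length cs))) -> s <= x).
  { intros x Hx; apply in_map_iff in Hx as (xs & <- & Hxs); auto. }
  unfold opt_cost; destruct (map _ _) as [|a L] eqn:E.
  - destruct Hne as (xs & Hxs); apply (in_map (path_cost t r cs)) in Hxs; rewrite E in Hxs.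
    destruct Hxs.
  - assert (Ha : s <= a) by (apply Hall; now left).
    assert (HL : forall x, In x L -> s <= x) by (intros; apply Hall; now right).
    clear E Hall; induction L as [|x L IH]; simpl; [exact Ha|].
    apply Rmin_glb; [apply HL; now left|]; apply IH; intros; apply HL; now right.
Qed.

End Algorithm.

Theorem theorem2 :
  exists K : R, 0 < K /\
  forall t : wtree, wf_tree t -> (2 <= length (leaves t))%nat ->
  exists alg : online_alg, valid_alg t alg /\
  forall (rho0 : nat) (cs : list costfun),
    In rho0 (leaves t) -> valid_costs t cs ->
    service_cost t alg rho0 cs <= opt_cost t rho0 cs /\
    movement_cost t alg rho0 cs <=
      K * INR (comb_depth t) * ln (INR (length (leaves t)))
        * (opt_cost t rho0 cs + diamX t).
Proof.
  (* Movement is at most [12 * eta * D * opt + 21 * D * diam]. As [eta = 2 * ln n] is at least 1,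
     the factor [21 * eta * D = 42 * D * ln n] covers both terms. *)
  exists 42; split; [lra|]; intros t Hwf Hn.
  exists (mirror_alg t); split; [now apply mirror_alg_valid|].
  intros r cs Hr Hcs; pose proof (distr_point t r Hr) as Hp0.
  destruct (run_bound t Hwf Hn r cs [] Hp0 Hcs) as (s & p & P1 & P2 & P3 & P4 & P5).
  unfold service_cost, movement_cost.
  change (fun (_ : costfun) (p x : nat) => tdist t p x) with (f_movement t).
  change (fun (c : costfun) (_ x : nat) => c x) with f_service.
  rewrite !expect_start by assumption.
  assert (Hs : s <= opt_cost t r cs).
  { apply opt_cost_ge; [exact Hn|]; intros xs Hxs; specialize (P4 r xs Hr Hxs).
    unfold state in P4; simpl in P4; rewrite bregman_point in P4 by exact Hr; lra. }
  split; [lra|]; eapply Rle_trans; [exact P5|].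
  pose proof (pot_diff t Hwf Hn (point r) p Hp0 P1) as HP.
  pose proof (emd_point_le_diam t Hwf r p Hr P1) as HE.
  pose proof (comb_depth_ge1 t Hwf Hn) as HD; pose proof (eta_ge1 t Hn) as He.
  unfold state; simpl fold_left.
  assert (Hdiam : 0 <= diamX t).
  { eapply Rle_trans; [|now apply (tdist_le_diam t r r)].
    apply tdist_nonneg; auto using leaves_lt. }
  set (D := INR (comb_depth t)) in *.
  replace (42 * D * ln (INR (length (leaves t)))) with (21 * eta t * D)
    by (unfold eta, nleaves; ring).
  assert (D <= eta t * D) by nra.
  assert (12 * eta t * D * s <= 12 * eta t * D * opt_cost t r cs)
    by (apply Rmult_le_compat_l; nra).
  assert (D * emd t (point r) p <= D * diamX t) by nra.
  assert (D * diamX t <= eta t * D * diamX t) by nra.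
  assert (0 <= eta t * D * opt_cost t r cs) by (apply Rmult_le_pos; nra).
  lra.
Qed.
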